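(* Let $\Gamma$ be a group and $f:\Gamma\to\mathcal{G}$ a group morphism such that ${\rm d}\circ f$ and $\eta:=\upsilon\circ f$ are distinct and nontrivial. Then the $N$-valued morphisms $r:=\rho\circ f$ and $\eta r$ are element conjugate in $N$. They are not $N$-conjugate if, and only if, none of the two projections $\Gamma\to{\rm O}(2)^{\pm}$ (the components of $f=(f_1,f_2)$) has an image isomorphic to the dihedral group ${\rm D}_8$ of order $8$.
   Context: Two morphisms $r,r':\Gamma\to G$ are element conjugate in $G$ if $r(\gamma)$ and $r'(\gamma)$ are conjugate in $G$ for every $\gamma\in\Gamma$; they are $G$-conjugate if there is $g\in G$ with $r'(\gamma)=g\,r(\gamma)\,g^{-1}$ for all $\gamma\in\Gamma$. The group $N$. Let $\pi:{\rm Spin}(7)\to{\rm SO}(7)$ be the canonical double cover (compact groups). Fix an orthogonal decomposition $\mathbb{R}^7=L\perp F$ with $L$ a line, and let $N\subset{\rm Spin}(7)$ be the inverse image under $\pi$ of the stabilizer of $L$ in ${\rm SO}(7)$. The identity component $N^0$ of $N$ (the subgroup acting with determinant $1$ on $F$) has index $2$, is isomorphic to ${\rm Spin}(6)$ and is identified with ${\rm SU}(4)$ via a fixed unitary half-spin representation. The central element $-1\in{\rm Spin}(7)$ lies in $N^0$, so a $\{\pm1\}$-valued character of $\Gamma$ can be multiplied with an $N$-valued morphism. The group $\mathcal{G}$. Equip $\mathbb{C}^2$ with the quadratic form $q(x,y)=x^2+y^2$. Let ${\rm GO}_2(\mathbb{C})$ be its group of similitudes, $\mu:{\rm GO}_2(\mathbb{C})\to\mathbb{C}^\times$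 the similitude factor ($q(gv)=\mu(g)q(v)$), and $\epsilon:{\rm GO}_2(\mathbb{C})\to\{\pm1\}$ the signature of the permutation action on the two isotropic lines of $q$. Let ${\rm O}(2)^{\pm}$ be the subgroup of elements $g$ with $\mu(g)=\pm1$ in the maximal compact subgroup ${\rm GO}(2)$ of ${\rm GO}_2(\mathbb{C})$; it is generated by the real orthogonal group ${\rm O}(2)$ and $i\cdot 1_2$. Let $\mathcal{G}$ be the group of $(g_1,g_2)\in{\rm O}(2)^{\pm}\times{\rm O}(2)^{\pm}$ with $\det g_1=\det g_2$ and $\mu(g_2)=\epsilon(g_1)$. Let $\rho:\mathcal{G}\to{\rm SU}(4)=N^0\subset N$ be the block-diagonal embedding $(g_1,g_2)\mapsto{\rm diag}(g_1,g_2)$. Define characters $\upsilon,{\rm d}:\mathcal{G}\to\{\pm1\}$ by $\upsilon(g_1,g_2)=\epsilon(g_1)=\mu(g_2)$ and ${\rm d}(g_1,g_2)=\det g_1=\det g_2$. *)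

(* Defs.v *)
From HB Require Import structures.
From mathcomp Require Import all_boot all_order all_algebra.
From mathcomp Require Import all_fingroup all_solvable spectral.
From mathcomp Require Import complex.
From mathcomp Require Import boolp reals ring.

Set Implicit Arguments.
Unset Strict Implicit.
Unset Printing Implicit Defensive.

Import Order.TTheory GRing.Theory Num.Theory.
Local Open Scope ring_scope.
Local Open Scope complex_scope.

(* The real Clifford algebra of the Euclidean space R^n, with the convention  *)
(* u^2 = - |u|^2 for vectors u (see iota_sqr). It has the basis e_A, A a      *)
(* subset of {0..n-1}, e_A being the product of the e_i (i in A) in           *)
(* increasing order; x A is the coordinate of x on e_A.                       *)

Section SymmetricDifference.
Variable n : nat.
Implicit Types A B C : {set 'I_n}.

Definition symd A B : {set 'I_n} := (A :\: B) :|: (B :\: A).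

Lemma in_symd A B i : (i \in symd A B) = (i \in A) (+) (i \in B).
Proof. by rewrite !inE; case: (i \in A); case: (i \in B). Qed.

Lemma symdA A B C : symd A (symd B C) = symd (symd A B) C.
Proof. by apply/setP=> i; rewrite !in_symd addbA. Qed.

Lemma symdC A B : symd A B = symd B A.
Proof. by apply/setP=> i; rewrite !in_symd addbC. Qed.

Lemma symdK A B : symd A (symd A B) = B.
Proof. by apply/setP=> i; rewrite !in_symd addbA addbb. Qed.

Lemma symd0 A : symd A set0 = A.
Proof. by apply/setP=> i; rewrite in_symd inE addbF. Qed.

Lemma sym0d A : symd set0 A = A.
Proof. by rewrite symdC symd0. Qed.

Lemma symd_eq A B C : (symd A B == C) = (B == symd A C).
Proof.
by apply/eqP/eqP => [<-|->]; rewrite symdK.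
Qed.

End SymmetricDifference.

Section CliffordSign.
Variables (R : comNzRingType) (n : nat).
Implicit Types A B C : {set 'I_n}.

(* e_A * e_B = clsign A B *: e_(symd A B): a pair b < a costs a transposition *)
(* and a pair b = a contributes e_a^2 = -1.                                   *)
Definition clsign A B : R := \prod_(a in A) \prod_(b in B) (-1) ^+ (b <= a)%N.

Lemma prod_symd (F : 'I_n -> R) A B : (forall i, F i * F i = 1) ->
  \prod_(a in symd A B) F a = (\prod_(a in A) F a) * \prod_(a in B) F a.
Proof.
move=> FF; rewrite big_mkcond [in RHS]big_mkcond [X in _ = _ * X]big_mkcond /=.
rewrite -big_split /=; apply: eq_bigr => i _; rewrite in_symd.
by case: (i \in A); case: (i \in B); rewrite ?mulr1 ?mul1r ?FF.
Qed.

Lemma clsign_symdl A B C : clsign (symd A B) C = clsign A C * clsign B C.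
Proof.
apply: prod_symd => i; rewrite -big_split big1 //= => j _.
by rewrite -expr2 sqrr_sign.
Qed.

Lemma clsign_symdr A B C : clsign A (symd B C) = clsign A B * clsign A C.
Proof.
rewrite /clsign -big_split /=; apply: eq_bigr => i _; apply: prod_symd => j.
by rewrite -expr2 sqrr_sign.
Qed.

Lemma clsign_sqr A B : clsign A B * clsign A B = 1.
Proof.
rewrite /clsign -big_split big1 //= => i _; rewrite -big_split big1 //= => j _.
by rewrite -expr2 sqrr_sign.
Qed.

Lemma clsign0r A : clsign A set0 = 1.
Proof. by rewrite /clsign big1 // => i _; rewrite big_set0. Qed.

Lemma clsign0l A : clsign set0 A = 1.
Proof. by rewrite /clsign big_set0. Qed.

Lemma clsign1 i j : clsign [set i] [set j] = (-1) ^+ (j <= i)%N.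
Proof. by rewrite /clsign !big_set1. Qed.

End CliffordSign.

Section Clifford.
Variables (R : comNzRingType) (n : nat).

Definition clifford := {ffun {set 'I_n} -> R^o}.

HB.instance Definition _ := GRing.Lmodule.on clifford.

Implicit Types x y z : clifford.

Definition cl_one : clifford := [ffun A => (A == set0)%:R].

Definition cl_mul x y : clifford :=
  [ffun C => \sum_A clsign R A (symd A C) * x A * y (symd A C)].

Lemma cl_mulA : associative cl_mul.
Proof.
move=> x y z; apply/ffunP=> C; rewrite !ffunE.
pose G A B : R := clsign R A (symd A C) * x A *
  (clsign R B (symd B (symd A C)) * y B * z (symd B (symd A C))).
transitivity (\sum_A \sum_B G A B).
  by apply: eq_bigr => A _; rewrite ffunE mulr_sumr.
rewrite exchange_big /=.
transitivity (\sum_B \sum_A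
    (clsign R B (symd B C) * (clsign R A (symd A B) * x A * y (symd A B))
       * z (symd B C))); last first.
  by apply: eq_bigr => B _; rewrite ffunE mulr_sumr mulr_suml.
rewrite [RHS]exchange_big [LHS]exchange_big /=.
apply: eq_bigr => A _; rewrite [RHS](reindex_inj (can_inj (symdK A))) /=.
apply: eq_bigr => B _; rewrite /G symdK.
rewrite -(symdA A B C); have -> : symd B (symd A C) = symd A (symd B C).
  by rewrite !symdA (symdC A).
rewrite !clsign_symdl !clsign_symdr.
move: (clsign_sqr R A B); move: (clsign R A B) => a aa.
move: (clsign R A C) (clsign R B C) => b c.
move: (clsign R A A) (clsign R B A) => d e.
move: (clsign R B B) (x A) (y B) (z _) => f.
change (R^o) with (R : Type) => u v w.
transitivity ((a * a) * (d * b * e * c * f * u * v * w)); last by ring.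
by rewrite aa; ring.
Qed.

Lemma cl_mul1l : left_id cl_one cl_mul.
Proof.
move=> x; apply/ffunP=> C; rewrite ffunE (bigD1 set0) //= big1.
  by rewrite ffunE eqxx clsign0l sym0d !mul1r addr0.
by move=> A /negPf A0; rewrite ffunE A0 mulr0 mul0r.
Qed.

Lemma cl_mul1r : right_id cl_one cl_mul.
Proof.
move=> x; apply/ffunP=> C; rewrite ffunE (bigD1 C) //= big1.
  rewrite ffunE addr0; have -> : symd C C = set0.
    by apply/setP=> i; rewrite in_symd addbb inE.
  by rewrite eqxx clsign0r mul1r mulr1.
by move=> A neqAC; rewrite ffunE symd_eq symd0 eq_sym (negPf neqAC) mulr0.
Qed.

Lemma cl_mulDl : left_distributive cl_mul +%R.
Proof.
move=> x y z; apply/ffunP=> C; rewrite !ffunE -big_split; apply: eq_bigr => A _.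
by rewrite ffunE mulrDr mulrDl.
Qed.

Lemma cl_mulDr : right_distributive cl_mul +%R.
Proof.
move=> x y z; apply/ffunP=> C; rewrite !ffunE -big_split; apply: eq_bigr => A _.
by rewrite ffunE mulrDr.
Qed.

Lemma cl_one_neq0 : cl_one != 0.
Proof.
by apply/eqP=> /ffunP/(_ set0); rewrite !ffunE eqxx => /eqP; rewrite oner_eq0.
Qed.

HB.instance Definition _ := GRing.Zmodule_isNzRing.Build clifford
  cl_mulA cl_mul1l cl_mul1r cl_mulDl cl_mulDr cl_one_neq0.

Lemma cl_scalerAl (a : R) x y : a *: (x * y) = (a *: x) * y.
Proof.
apply/ffunP=> C; rewrite !ffunE scaler_sumr; apply: eq_bigr => A _.
by rewrite ffunE /GRing.scale /= !mulrA [a * _]mulrC.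
Qed.

HB.instance Definition _ :=
  GRing.Lmodule_isLalgebra.Build R clifford cl_scalerAl.

Lemma cl_scalerAr (a : R) x y : a *: (x * y) = x * (a *: y).
Proof.
apply/ffunP=> C; rewrite !ffunE scaler_sumr; apply: eq_bigr => A _.
by rewrite ffunE /GRing.scale /= mulrCA.
Qed.

HB.instance Definition _ :=
  GRing.Lalgebra_isAlgebra.Build R clifford cl_scalerAr.

Definition cl_unit : pred clifford :=
  fun x => `[< exists y, y * x = 1 /\ x * y = 1 >].

Definition cl_inv x : clifford :=
  if pselect (exists y, y * x = 1 /\ x * y = 1) is left h
  then projT1 (cid h) else x.

Lemma cl_mulVr : {in cl_unit, left_inverse 1 cl_inv *%R}.
Proof.
by move=> x /asboolP h; rewrite /cl_inv; case: pselect => // k; case: cid => y [].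
Qed.

Lemma cl_mulrV : {in cl_unit, right_inverse 1 cl_inv *%R}.
Proof.
by move=> x /asboolP h; rewrite /cl_inv; case: pselect => // k; case: cid => y [].
Qed.

Lemma cl_unitP x y : y * x = 1 /\ x * y = 1 -> cl_unit x.
Proof. by move=> h; apply/asboolP; exists y. Qed.

Lemma cl_inv_out : {in [predC cl_unit], cl_inv =1 id}.
Proof.
by move=> x /asboolPn h; rewrite /cl_inv; case: pselect.
Qed.

HB.instance Definition _ := GRing.NzRing_hasMulInverse.Build clifford
  cl_mulVr cl_mulrV cl_unitP cl_inv_out.

Definition cl_basis (A : {set 'I_n}) : clifford := [ffun B => (B == A)%:R].

Definition iota_cl (u : 'cV[R]_n) : clifford :=
  \sum_i u i 0 *: cl_basis [set i].

Definition dotv (u w : 'cV[R]_n) : R := (u^T *m w) 0 0.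

Lemma cl_basisM A B :
  cl_basis A * cl_basis B = clsign R A B *: cl_basis (symd A B).
Proof.
apply/ffunP=> C; rewrite !ffunE (bigD1 A) //= big1 => [|D /negPf DA]; last first.
  by rewrite ffunE DA mulr0 mul0r.
rewrite !ffunE eqxx mulr1 addr0 symd_eq.
by case: eqP => [->|_]; rewrite ?symdK ?mulr0 ?scaler0.
Qed.

Lemma iota_clP : linear iota_cl.
Proof.
move=> a u w; rewrite /iota_cl scaler_sumr -big_split; apply: eq_bigr => i _.
by rewrite !mxE scalerDl scalerA.
Qed.

HB.instance Definition _ :=
  GRing.isLinear.Build R 'cV[R]_n clifford _ iota_cl iota_clP.

Lemma cl_gen_anticomm i j : cl_basis [set i] * cl_basis [set j] +
  cl_basis [set j] * cl_basis [set i] = (- (2%:R * (i == j)%:R))%:A.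
Proof.
rewrite !cl_basisM !clsign1 (symdC [set j]) -scalerDl.
case: (ltngtP i j) => [ij|ij|/val_inj ->].
- have /negPf-> : i != j by rewrite neq_ltn ij.
  by rewrite mulr0 oppr0 subrr !scale0r.
- have /negPf-> : i != j by rewrite neq_ltn ij orbT.
  by rewrite mulr0 oppr0 addNr !scale0r.
rewrite eqxx mulr1 -opprD; congr (_ *: _); apply/ffunP=> A; rewrite !ffunE.
by congr (_ == _)%:R; apply/setP=> k; rewrite in_symd addbb inE.
Qed.

Lemma iota_anticomm (u w : 'cV[R]_n) :
  iota_cl u * iota_cl w + iota_cl w * iota_cl u = (- (2%:R * dotv u w))%:A.
Proof.
rewrite /iota_cl !mulr_suml.
under eq_bigr => i _ do rewrite mulr_sumr.
under [X in _ + X]eq_bigr => i _ do rewrite mulr_sumr.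
rewrite [X in _ + X]exchange_big -big_split /=.
rewrite /dotv mxE mulr_sumr -sumrN scaler_suml; apply: eq_bigr => i _.
rewrite -big_split /= (bigD1 i) //= big1 ?addr0 => [|j /negPf ji].
  rewrite -!scalerAl -!scalerAr !scalerA (mulrC (w i 0)).
  rewrite -scalerDr cl_gen_anticomm eqxx mulr1 scalerA mxE.
  by congr (_ *: _); ring.
rewrite -!scalerAl -!scalerAr !scalerA (mulrC (w j 0)) -scalerDr.
by rewrite cl_gen_anticomm eq_sym ji mulr0 oppr0 scale0r scaler0.
Qed.

End Clifford.

(* The group structure on a subset of a ring that is a subgroup of its units. *)
Section SubgroupOfUnits.
Variable A : unitRingType.

Definition unit_subgroup (P : pred A) :=
  [/\ P 1, forall x, P x -> x \is a GRing.unit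
    & forall x y, P x -> P y -> P (x / y)].

Definition units_of (P : pred A) & unit_subgroup P := {x : A | P x}.

Variables (P : pred A) (h : unit_subgroup P).
Local Notation G := (units_of h).

HB.instance Definition _ := SubChoice.on G.

Fact units_of_inv_subproof (x : G) : P (val x)^-1.
Proof. by case: h => P1 _ Pdiv; rewrite -div1r Pdiv ?(valP x). Qed.

Fact units_of_mul_subproof (x y : G) : P (val x * val y).
Proof.
case: h => _ _ Pdiv; rewrite -[val y]invrK.
exact: Pdiv (valP x) (units_of_inv_subproof y).
Qed.

Definition units_of_one : G := let: And3 P1 _ _ := h in Sub 1 P1.
Definition units_of_inv (x : G) : G := Sub _ (units_of_inv_subproof x).
Definition units_of_mul (x y : G) : G := Sub _ (units_of_mul_subproof x y).

Fact val_units_of_one : val units_of_one = 1.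
Proof. by rewrite /units_of_one; case: h => ? ? ?; rewrite SubK. Qed.

Fact val_units_unit (x : G) : val x \is a GRing.unit.
Proof. by case: h => _ U _; apply/U/(valP x). Qed.

Fact units_of_mulA : associative units_of_mul.
Proof. by move=> x y z; apply: val_inj; rewrite !SubK mulrA. Qed.

Fact units_of_mul1 : left_id units_of_one units_of_mul.
Proof. by move=> x; apply: val_inj; rewrite SubK val_units_of_one mul1r. Qed.

Fact units_of_mulr1 : right_id units_of_one units_of_mul.
Proof. by move=> x; apply: val_inj; rewrite SubK val_units_of_one mulr1. Qed.

Fact units_of_mulV : left_inverse units_of_one units_of_inv units_of_mul.
Proof.
move=> x; apply: val_inj.
by rewrite !SubK val_units_of_one mulVr ?val_units_unit.
Qed.

Fact units_of_mulrV : right_inverse units_of_one units_of_inv units_of_mul.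
Proof.
move=> x; apply: val_inj.
by rewrite !SubK val_units_of_one mulrV ?val_units_unit.
Qed.

HB.instance Definition _ := isGroup.Build G units_of_mulA units_of_mul1
  units_of_mulr1 units_of_mulV units_of_mulrV.

Lemma val_unitsM (x y : G) : val (x * y)%g = val x * val y.
Proof. by rewrite SubK. Qed.

Lemma val_units1 : val (1%g : G) = 1.
Proof. exact: val_units_of_one. Qed.

Lemma val_unitsV (x : G) : val (x^-1)%g = (val x)^-1.
Proof. by rewrite SubK. Qed.

End SubgroupOfUnits.

Section Spin.
Variables (R : realType) (n : nat).
Local Notation Cl := (clifford R n).
Local Notation vec := 'cV[R]_n.

Definition is_spin (x : Cl) := exists s : seq vec,
  [/\ forall u, u \in s -> dotv u u = 1, ~~ odd (size s)
    & x = \prod_(u <- s) iota_cl u].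

Definition spin_pred : pred Cl := fun x => `[< is_spin x >].

Lemma iota_sqr (u : vec) : iota_cl u * iota_cl u = (- dotv u u)%:A.
Proof.
apply: (@scalerI _ _ (2%:R : R)); first by rewrite pnatr_eq0.
by rewrite scalerA mulrN -iota_anticomm scaler_nat mulr2n.
Qed.

Lemma iota_unit (u : vec) : dotv u u = 1 ->
  iota_cl u \is a GRing.unit /\ (iota_cl u)^-1 = iota_cl (- u).
Proof.
move=> u1; have E : iota_cl (- u) * iota_cl u = 1.
  by rewrite linearN mulNr iota_sqr u1 scaleN1r opprK.
have E' : iota_cl u * iota_cl (- u) = 1.
  by rewrite linearN mulrN iota_sqr u1 scaleN1r opprK.
have U : iota_cl u \is a GRing.unit by apply/unitrP; exists (iota_cl (- u)).
by split => //; rewrite -[RHS](mulrK U) E mul1r.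
Qed.

Lemma dotvN (u : vec) : dotv (- u) (- u) = dotv u u.
Proof. by rewrite /dotv mulmxN [_^T]linearN mulNmx opprK. Qed.

Lemma spin_prodV (s : seq vec) : (forall u, u \in s -> dotv u u = 1) ->
  \prod_(u <- s) iota_cl u \is a GRing.unit /\
  (\prod_(u <- s) iota_cl u)^-1 = \prod_(u <- rev (map -%R s)) iota_cl u.
Proof.
elim: s => [|u s IHs] Hs; first by rewrite !big_nil unitr1 invr1.
have [Us Es] := IHs (fun w ws => Hs w (mem_behead (s := u :: s) ws)).
have [Uu Eu] := iota_unit (Hs u (mem_head u s)).
rewrite big_cons unitrMl // Uu invrM // Es Eu map_cons rev_cons.
by rewrite -cats1 big_cat big_seq1.
Qed.

Lemma spin_subgroup : unit_subgroup spin_pred.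
Proof.
split.
- by apply/asboolP; exists [::]; rewrite big_nil.
- by move=> x /asboolP[s [Hs _ ->]]; case: (spin_prodV Hs).
move=> x y /asboolP[s [Hs es ->]] /asboolP[t [Ht et ->]].
have [_ ->] := spin_prodV Ht; apply/asboolP.
exists (s ++ rev (map -%R t)); split; last by rewrite big_cat.
  move=> u; rewrite mem_cat mem_rev => /orP[/Hs //|/mapP[w /Ht w1 ->]].
  by rewrite dotvN.
by rewrite size_cat size_rev size_map oddD negb_add (negPf es) (negPf et).
Qed.

Definition spin := units_of spin_subgroup.

HB.instance Definition _ := SubChoice.on spin.
HB.instance Definition _ := Group.on spin.

Definition spin_val (x : spin) : Cl := val x.
Coercion spin_val : spin >-> clifford.

Lemma spin_valM (x y : spin) : spin_val (x * y)%g = spin_val x * spin_val y.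
Proof. exact: val_unitsM. Qed.

Lemma spin_val1 : spin_val 1%g = 1.
Proof. exact: val_units1. Qed.

Lemma spin_val_unit (x : spin) : spin_val x \is a GRing.unit.
Proof. exact: val_units_unit. Qed.

(* The covering pi : Spin(n) -> SO(n), characterized by coverE below. *)
Definition spin_cover (x : spin) : 'M[R]_n :=
  \matrix_(i, j) (spin_val x * iota_cl (delta_mx j 0) / spin_val x) [set i].

Lemma iota_coord (u : vec) i : iota_cl u [set i] = u i 0.
Proof.
rewrite /iota_cl sum_ffunE (bigD1 i) //= big1 => [|j ji]; rewrite !ffunE.
  by rewrite eqxx addr0 /GRing.scale /= mulr1.
by rewrite (inj_eq set1_inj) eq_sym (negPf ji) scaler0.
Qed.

Lemma iota_inj : injective (@iota_cl R n).
Proof.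
move=> u w E; apply/matrixP=> i j; rewrite ord1.
by rewrite -!iota_coord E.
Qed.

Lemma reflE (u w : vec) : dotv u u = 1 ->
  iota_cl u * iota_cl w * iota_cl (- u) = iota_cl (2%:R * dotv u w *: u - w).
Proof.
move=> u1; have /eqP := iota_anticomm u w; rewrite eq_sym -subr_eq => /eqP <-.
rewrite linearN mulrN mulrBl -mulrA iota_sqr u1 scaleN1r mulrN1 opprB.
by rewrite -scalerAl mul1r scaleNr opprK linearB linearZ /= addrC.
Qed.

Lemma spin_vec (x : spin) u : exists w, spin_val x * iota_cl u / spin_val x = iota_cl w.
Proof.
case: x => x /=; rewrite /spin_val /= => /asboolP[s [Hs _ ->]]; have [_ ->] := spin_prodV Hs.
elim: s Hs => [|w s IHs] Hs; first by exists u; rewrite !big_nil mul1r mulr1.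
have [u' E] := IHs (fun w ws => Hs w (mem_behead (s := _ :: s) ws)).
exists (2%:R * dotv w u' *: w - u'); rewrite -reflE ?Hs ?mem_head // -E.
by rewrite map_cons rev_cons -cats1 big_cat big_seq1 big_cons !mulrA.
Qed.

Lemma coverE (x : spin) u :
  spin_val x * iota_cl u / spin_val x = iota_cl (spin_cover x *m u).
Proof.
have E j : spin_val x * iota_cl (delta_mx j 0) / spin_val x = iota_cl (col j (spin_cover x)).
  have [w Ew] := spin_vec x (delta_mx j 0); rewrite Ew; congr iota_cl.
  by apply/matrixP=> i k; rewrite !mxE Ew iota_coord ord1.
have -> : spin_cover x *m u = \sum_j u j 0 *: col j (spin_cover x).
  apply/matrixP=> i k; rewrite ord1 !mxE summxE; apply: eq_bigr => j _.
  by rewrite !mxE mulrC.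
have {1}-> : u = \sum_j u j 0 *: delta_mx j 0.
  rewrite {1}[u]matrix_sum_delta; apply: eq_bigr => i _.
  by rewrite big_ord1.
rewrite !linear_sum mulr_sumr mulr_suml; apply: eq_bigr => j _.
by rewrite !linearZ /= -E -scalerAr -scalerAl.
Qed.

Lemma coverM (x y : spin) : spin_cover (x * y)%g = spin_cover x *m spin_cover y.
Proof.
suff E (u : vec) : spin_cover (x * y)%g *m u = spin_cover x *m spin_cover y *m u.
  apply/matrixP=> i j; have /matrixP/(_ i 0) := E (delta_mx j 0).
  by rewrite -!colE !mxE.
apply: iota_inj; rewrite -mulmxA -!coverE spin_valM.
by rewrite invrM ?spin_val_unit // !mulrA.
Qed.

Lemma cover1 : spin_cover 1%g = 1%:M.
Proof.
apply/matrixP=> i j; rewrite mxE spin_val1 invr1 mul1r mulr1 iota_coord.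
by rewrite !mxE eqxx andbT.
Qed.

End Spin.

(* The decomposition R^7 = L + F is given by a spanning vector v of L, and    *)
(* F is the orthogonal complement of v.                                       *)
Section StabilizerOfLine.
Variables (R : realType) (v : 'cV[R]_7).
Local Notation Spin7 := (spin R 7).

Definition stab_line : pred Spin7 := fun x => spin_cover x *m v \in <[v]>%VS.

Lemma stab_line_group : group_closed stab_line.
Proof.
have stabM x y : stab_line x -> stab_line y -> stab_line (x * y)%g.
  rewrite /stab_line coverM -mulmxA => /vlineP[a Ea] /vlineP[b ->].
  by rewrite -scalemxAr Ea memvZ // memvZ // memv_line.
have stabV x : stab_line x -> stab_line (x^-1)%g.
  have [v0|v0] := eqVneq v 0; first by rewrite /stab_line v0 !mulmx0 mem0v.
  rewrite /stab_line => /vlineP[a Ea].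
  have E : a *: (spin_cover (x^-1)%g *m v) = v.
    by rewrite scalemxAr -Ea mulmxA -coverM mulVg cover1 mul1mx.
  have a0 : a != 0 by apply: contraNneq v0 => a0; rewrite -E a0 scale0r.
  by apply/vlineP; exists a^-1; rewrite -{2}E scalerA mulVf // scale1r.
split; first by rewrite unfold_in /stab_line cover1 mul1mx memv_line.
by move=> x y Hx Hy; apply: stabM => //; apply: stabV.
Qed.

Definition N := {x : Spin7 | stab_line x}.

HB.instance Definition _ := SubChoice.on N.
HB.instance Definition _ :=
  SubChoice_isSubGroup.Build Spin7 stab_line N stab_line_group.

Definition N_val (x : N) : Spin7 := val x.
Coercion N_val : N >-> spin.

Definition proj_line : 'M[R]_7 := (dotv v v)^-1 *: (v *m v^T).

(* The determinant of x on F is that of the endomorphism of R^7 equal to the  *)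
(* identity on L and to x on F.                                               *)
Definition N0 : pred N := fun x =>
  \det (spin_cover x *m (1%:M - proj_line) + proj_line) == 1.

(* The even Clifford algebra of F, whose unit group contains Spin(F) = N0.    *)
Inductive even_clifford_perp : clifford R 7 -> Prop :=
| EvenOne : even_clifford_perp 1
| EvenGen u w : dotv u v = 0 -> dotv w v = 0 ->
    even_clifford_perp (iota_cl u * iota_cl w)
| EvenLin a x y : even_clifford_perp x -> even_clifford_perp y ->
    even_clifford_perp (a *: x + y)
| EvenMul x y : even_clifford_perp x -> even_clifford_perp y ->
    even_clifford_perp (x * y).

Fact neg1_is_spin : spin_pred (-1 : clifford R 7).
Proof.
apply/asboolP; pose e : 'cV[R]_7 := delta_mx 0 0.
have e1 : dotv e e = 1 by rewrite /dotv trmx_delta mul_delta_mx mxE eqxx.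
exists [:: e; e]; split=> //.
  by move=> u; rewrite !inE => /orP[] /eqP ->.
by rewrite big_cons big_seq1 iota_sqr e1 scaleN1r.
Qed.

Definition neg1_spin : Spin7 := Sub _ neg1_is_spin.

Fact neg1_stab : stab_line neg1_spin.
Proof.
rewrite /stab_line (_ : spin_cover _ = 1%:M) ?mul1mx ?memv_line //.
apply/matrixP=> i j; rewrite mxE /spin_val SubK invrN1 mulrN1 mulN1r opprK iota_coord.
by rewrite !mxE eqxx andbT.
Qed.

Definition neg1 : N := Sub _ neg1_stab.

End StabilizerOfLine.

Arguments N0 {R} v.
Arguments neg1 {R} v.
Arguments even_clifford_perp {R} v.

Section SU4.
Variable R : realType.

Definition SU4 (A : 'M[R[i]]_4) : Prop := A \is unitarymx /\ \det A = 1.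

(* The identification of N0 = Spin(F) with SU(4) by a unitary half-spin       *)
(* representation. A half-spin representation is the restriction to Spin(F)   *)
(* of a 4-dimensional complex representation of the even Clifford algebra of  *)
(* F; as dim F = 6, the latter is irreducible. Only the restriction of        *)
(* half_spin_map to even_clifford_perp v is relevant.                         *)
Record half_spin (v : 'cV[R]_7) := HalfSpin {
  half_spin_map :> clifford R 7 -> 'M[R[i]]_4;
  su4_inv : 'M[R[i]]_4 -> N v;
  half_spin1 : half_spin_map 1 = 1%:M;
  half_spinP : forall a x y,
    even_clifford_perp v x -> even_clifford_perp v y ->
    half_spin_map (a *: x + y) = a%:C *: half_spin_map x + half_spin_map y;
  half_spinM : forall x y,
    even_clifford_perp v x -> even_clifford_perp v y ->
    half_spin_map (x * y) = half_spin_map x *m half_spin_map y;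
  half_spin_SU4 : forall x, N0 v x -> SU4 (half_spin_map x);
  su4_invK : forall A, SU4 A -> half_spin_map (su4_inv A) = A;
  su4_inv_N0 : forall A, SU4 A -> N0 v (su4_inv A);
  half_spinK : forall x, N0 v x -> su4_inv (half_spin_map x) = x
}.

End SU4.

Section O2pm.
Variable R : realType.
Local Notation C := R[i].
Implicit Types g h : 'M[C]_2.

Definition qform (w : 'cV[C]_2) : C := w 0 0 ^+ 2 + w 1 0 ^+ 2.

(* As qform (1, 0) = 1, this is the only possible similitude factor of g.     *)
Definition simf g : C := qform (g *m delta_mx 0 0).

Definition GO2C g : Prop :=
  g \in unitmx /\ forall w, qform (g *m w) = simf g * qform w.

(* The maximal compact subgroup of GO2C, generated by O(2) and the scalars    *)
(* of modulus 1, consists of its unitary elements.                            *)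
Definition GO2 g : Prop := GO2C g /\ g \is unitarymx.

Definition is_O2pm g : Prop := GO2 g /\ (simf g = 1 \/ simf g = -1).

Definition O2pm_pred : pred 'M[C]_2 := fun g => `[< is_O2pm g >].

Lemma simfM g h : GO2C g -> simf (g *m h) = simf g * simf h.
Proof. by case=> _ Hg; rewrite {1}/simf -mulmxA Hg. Qed.

Lemma simf1 : simf 1%:M = 1.
Proof. by rewrite /simf mul1mx /qform !mxE /= expr1n expr0n addr0. Qed.

Lemma GO2C_M g h : GO2C g -> GO2C h -> GO2C (g *m h).
Proof.
move=> Gg [Uh Hh]; case: (Gg) => Ug Hg; split; first by rewrite unitmx_mul Ug.
by move=> w; rewrite simfM // -mulmxA Hg Hh mulrA.
Qed.

Lemma GO2C_V g : GO2C g -> GO2C (invmx g) /\ simf g * simf (invmx g) = 1.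
Proof.
case=> Ug Hg.
have E w : simf g * qform (invmx g *m w) = qform w by rewrite -Hg mulKVmx.
have E1 : simf g * simf (invmx g) = 1 by rewrite E -[delta_mx 0 0]mul1mx -/(simf _) simf1.
split=> //; split; first by rewrite unitmx_inv.
by move=> w; rewrite -(E w) mulrA (mulrC (simf (invmx g))) E1 mul1r.
Qed.

Lemma O2pm_subgroup : unit_subgroup O2pm_pred.
Proof.
split.
- apply/asboolP; split; last by left; rewrite simf1.
  split; last by apply/unitarymxP; rewrite mul1mx trmx1 map_mx1.
  by split; [exact: unitmx1 | move=> w; rewrite mul1mx simf1 mul1r].
- by move=> g /asboolP[[[]]].
move=> g h /asboolP[[Gg Ug] sg] /asboolP[[Gh Uh] sh]; apply/asboolP.
rewrite -[g / h]/(g *m invmx h).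
have [Gh' sh'] := GO2C_V Gh; split; first split.
- exact: GO2C_M.
- have -> := invmx_unitary Uh.
  by apply: mul_unitarymx Ug _; rewrite trmxC_unitary.
rewrite simfM //; have -> : simf (invmx h) = simf h.
  by case: sh sh' => -> ; rewrite ?mul1r // mulN1r => /(canRL (@opprK _)).
by case: sg sh => -> [] ->; rewrite ?mulN1r ?mul1r ?opprK; auto.
Qed.

Definition O2pm := units_of O2pm_subgroup.

HB.instance Definition _ := SubChoice.on O2pm.
HB.instance Definition _ := Group.on O2pm.

Definition O2pm_mx (g : O2pm) : 'M[C]_2 := val g.
Coercion O2pm_mx : O2pm >-> matrix.

Lemma O2pm_mxM (g h : O2pm) : O2pm_mx (g * h)%g = O2pm_mx g *m O2pm_mx h.
Proof. exact: val_unitsM. Qed.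

Lemma O2pm_mx1 : O2pm_mx 1%g = 1%:M.
Proof. exact: val_units1. Qed.

(* The isotropic lines of qform are spanned by (1, i) and (1, -i).            *)
Definition iso_vec (j : 'I_2) : 'cV[C]_2 :=
  \col_k (if k == 0 then 1 else (-1) ^+ j * 'i%C).

Definition permutes_lines g (s : 'S_2) : bool :=
  [forall j, g *m iso_vec j \in <[iso_vec (s j)]>%VS].

Definition line_perm g : 'S_2 := odflt 1%g [pick s | permutes_lines g s].

Definition epsilon g : C := (-1) ^+ line_perm g.

Lemma iso_lineP (w : 'cV[C]_2) j :
  (w \in <[iso_vec j]>%VS) = (w 1 0 == (-1) ^+ j * 'i%C * w 0 0).
Proof.
apply/vlineP/eqP => [[k ->]|E]; first by rewrite !mxE /= mulr1 mulrC.
exists (w 0 0); apply/matrixP=> a b; rewrite ord1 !mxE.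
case: (unliftP 0 a) => [a' ->|->]; rewrite ?mulr1 // ord1 /=.
by rewrite [RHS]mulrC -E; congr (w _ 0); apply: val_inj.
Qed.

Lemma iso_vec_neq0 j : iso_vec j != 0.
Proof.
by apply/eqP=> /matrixP/(_ 0 0) /eqP; rewrite !mxE eqxx oner_eq0.
Qed.

Lemma sqr_i : 'i%C * 'i%C = -1 :> C.
Proof. by rewrite -expr2 sqr_i. Qed.

Lemma iso_line_uniq (w : 'cV[C]_2) j k : w != 0 ->
  w \in <[iso_vec j]>%VS -> w \in <[iso_vec k]>%VS -> j = k.
Proof.
rewrite !iso_lineP => w0 /eqP Ej /eqP; rewrite Ej => /eqP.
have w00 : w 0 0 != 0.
  apply: contraNneq w0 => E; apply/eqP/matrixP=> a b; rewrite ord1 mxE.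
  case: (unliftP 0 a) => [a' ->|-> //]; rewrite ord1.
  by rewrite (_ : lift 0 0 = 1) ?Ej ?E ?mulr0 //; apply: val_inj.
have i0 : 'i%C != 0 :> C.
  by apply/eqP=> i0; have /eqP := sqr_i; rewrite i0 mul0r eq_sym oppr_eq0 oner_eq0.
rewrite (inj_eq (mulIf w00)) (inj_eq (mulIf i0)).
rewrite -signr_odd -[X in _ == X]signr_odd (inj_eq (@signr_inj _)).
by case: j {Ej} => [[|[|]]] ? //; case: k => [[|[|]]] ? // _; apply: val_inj.
Qed.

Lemma permutes_lines_uniq g s t : g \in unitmx ->
  permutes_lines g s -> permutes_lines g t -> s = t.
Proof.
move=> Ug /forallP Hs /forallP Ht; apply/permP=> j.
apply: iso_line_uniq (Hs j) (Ht j).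
by apply: contraNneq (iso_vec_neq0 j) => E; rewrite -(mulKmx Ug (iso_vec j)) E mulmx0.
Qed.

Lemma permutes_linesM g h s t : permutes_lines g s -> permutes_lines h t ->
  permutes_lines (g *m h) (t * s)%g.
Proof.
move=> /forallP Hs /forallP Ht; apply/forallP=> j; rewrite permM -mulmxA.
have /vlineP[k ->] := Ht j; rewrite -scalemxAr memvZ //; exact: Hs.
Qed.

Lemma qform_iso (w : 'cV[C]_2) : qform w = 0 ->
  exists j, w \in <[iso_vec j]>%VS.
Proof.
move=> q0; have : (w 1 0 - 'i%C * w 0 0) * (w 1 0 + 'i%C * w 0 0) = 0.
  rewrite -subr_sqr exprMn (expr2 'i%C) sqr_i mulN1r opprK -q0 addrC.
  by [].
move=> /eqP; rewrite mulf_eq0 subr_eq0 addr_eq0 => /orP[] /eqP E.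
  by exists 0; rewrite iso_lineP E expr0 mul1r.
by exists 1; rewrite iso_lineP E expr1 mulN1r mulNr.
Qed.

Lemma permutes_lines_ex g : GO2C g -> exists s, permutes_lines g s.
Proof.
case=> Ug Hg.
have H j : exists k, g *m iso_vec j \in <[iso_vec k]>%VS.
  apply: qform_iso; rewrite Hg /qform !mxE /= exprMn -exprM mulnC exprM.
  by rewrite sqrrN expr1n expr1n mul1r (expr2 'i%C) sqr_i subrr mulr0.
pose f j := xchoose (H j).
have fP j : g *m iso_vec j \in <[iso_vec (f j)]>%VS := xchooseP (H j).
have f_inj : injective f.
  move=> j k E; have /vlineP[a Ea] := fP j; have /vlineP[b Eb] := fP k.
  have a0 : a != 0.
    apply: contraNneq (iso_vec_neq0 j) => a0.
    by rewrite -(mulKmx Ug (iso_vec j)) Ea a0 scale0r mulmx0.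
  apply: (iso_line_uniq (iso_vec_neq0 k)); last exact: memv_line.
  apply/vlineP; exists (b / a).
  rewrite -(mulKmx Ug (iso_vec k)) -(mulKmx Ug (iso_vec j)) Ea Eb E.
  by rewrite -scalemxAr -scalemxAr scalerA divfK.
by exists (perm f_inj); apply/forallP=> j; rewrite permE.
Qed.

Lemma line_permP g : GO2C g -> permutes_lines g (line_perm g).
Proof.
move=> /permutes_lines_ex[s Hs]; rewrite /line_perm.
by case: pickP => [//|/(_ s)]; rewrite Hs.
Qed.

Lemma epsilonM g h : GO2C g -> GO2C h ->
  epsilon (g *m h) = epsilon g * epsilon h.
Proof.
move=> Gg Gh; rewrite /epsilon -signr_addb addbC -odd_permM.
congr (_ ^+ odd_perm _).
apply: (@permutes_lines_uniq (g *m h)); first by case: (GO2C_M Gg Gh).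
  exact/line_permP/GO2C_M.
by apply: permutes_linesM; apply: line_permP.
Qed.

End O2pm.

Section CalG.
Variable R : realType.
Local Notation C := R[i].
Local Notation O2 := (O2pm R).

Definition calG_pred : pred (O2 * O2) := fun g =>
  (\det g.1 == \det g.2) && (simf g.2 == epsilon g.1).

Lemma O2pm_GO2C (g : O2) : GO2C g.
Proof. by case/asboolP: (valP g) => [[]]. Qed.

Lemma calG_group : group_closed calG_pred.
Proof.
have e1 : epsilon (1%:M : 'M[C]_2) = 1.
  have G1 : GO2C (1%:M : 'M[C]_2) by have := O2pm_GO2C 1%g; rewrite O2pm_mx1.
  have := epsilonM G1 G1; rewrite mul1mx /epsilon.
  by case: (odd_perm _); rewrite ?mulrNN ?mulr1.
have GM x y : calG_pred x -> calG_pred y -> calG_pred (x * y)%g.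
  move=> /andP[/eqP dx /eqP ex] /andP[/eqP dy /eqP ey]; apply/andP.
  rewrite -[(x * y)%g]/(x.1 * y.1, x.2 * y.2)%g /= !O2pm_mxM !det_mulmx dx dy eqxx.
  split=> //.
  by rewrite simfM ?epsilonM ?ex ?ey //; apply: O2pm_GO2C.
have GV x : calG_pred x -> calG_pred (x^-1)%g.
  move=> /andP[/eqP dx /eqP ex]; apply/andP.
  have V1 (y : O2) : y *m (O2pm_mx (y^-1)%g) = 1%:M.
    by rewrite -O2pm_mxM mulgV O2pm_mx1.
  have D (y : O2) : \det y * \det (O2pm_mx (y^-1)%g) = 1.
    by rewrite -det_mulmx V1 det1.
  have E (y : O2) : epsilon y * epsilon (O2pm_mx (y^-1)%g) = 1.
    by rewrite -epsilonM ?V1 //; apply: O2pm_GO2C.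
  have S (y : O2) : simf y * simf (O2pm_mx (y^-1)%g) = 1.
    by rewrite -simfM ?V1 ?simf1 //; apply: O2pm_GO2C.
  have inv_eq (a b c d : C) : a * b = 1 -> c * d = 1 -> a = c -> b = d.
    move=> ab cd ac; rewrite -[b]mul1r -cd -ac -mulrA (mulrC d) mulrA ab.
    exact: mul1r.
  split; apply/eqP; first exact: inv_eq (D x.1) (D x.2) dx.
  exact: inv_eq (S x.2) (E x.1) ex.
split=> [|x y Hx Hy]; last exact: GM Hx (GV y Hy).
by rewrite unfold_in /calG_pred /= !O2pm_mx1 eqxx simf1 e1 eqxx.
Qed.

Definition calG := {g : O2 * O2 | calG_pred g}.

HB.instance Definition _ := SubChoice.on calG.
HB.instance Definition _ :=
  SubChoice_isSubGroup.Build (O2 * O2)%type calG_pred calG calG_group.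

Definition calG_fst (g : calG) : O2 := (val g).1.
Definition calG_snd (g : calG) : O2 := (val g).2.

Definition upsilon (g : calG) : C := epsilon (calG_fst g).

Definition dchar (g : calG) : C := \det (calG_fst g).

Definition rho_mx (g : calG) : 'M[C]_4 :=
  block_mx (calG_fst g : 'M_2) 0 0 (calG_snd g) : 'M_(2 + 2).

Lemma det_O2pm (g : O2) : \det g * \det g = 1.
Proof.
have [_ Hg] := O2pm_GO2C g.
have H0 := Hg (delta_mx 0 0); have H1 := Hg (delta_mx 1 0).
have H2 := Hg (delta_mx 0 0 + delta_mx 1 0).
have -> : \det g = g 0 0 * g 1 1 - g 0 1 * g 1 0.
  rewrite (expand_det_row _ 0) !big_ord_recl big_ord0 /cofactor !det_mx11 !mxE.
  rewrite /= addr0 expr0 expr1 mul1r mulN1r mulrN.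
  by congr (_ * g _ _ - g _ _ * g _ _); apply: val_inj.
have mm : simf g * simf g = 1.
  by case/asboolP: (valP g) => _ [] ->; rewrite ?mulrNN mulr1.
move: H0 H1 H2; rewrite /qform mulmxDr -!colE !mxE /=.
rewrite !expr0n !expr1n /= !(add0r, addr0, mulr1) expr1n.
move: (g 0 0) (g 0 1) (g 1 0) (g 1 1) (simf g) mm => a b c d m mm H0 H1 H2.
have ab : (a * b + c * d) *+ 2 = 0.
  have -> : (a * b + c * d) *+ 2 =
    ((a + b) ^+ 2 + (c + d) ^+ 2) - (a ^+ 2 + c ^+ 2) - (b ^+ 2 + d ^+ 2) by ring.
  by rewrite H0 H1 H2; ring.
move/eqP: ab; rewrite mulrn_eq0 /= => /eqP ab.
have -> : (a * d - b * c) * (a * d - b * c) =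
  (a ^+ 2 + c ^+ 2) * (b ^+ 2 + d ^+ 2) - (a * b + c * d) ^+ 2 by ring.
by rewrite H0 H1 ab mm expr0n subr0.
Qed.

Lemma rho_mx_SU4 g : SU4 (rho_mx g).
Proof.
have U (h : O2) : O2pm_mx h \is unitarymx by case/asboolP: (valP h) => [[]].
split; last first.
  rewrite /rho_mx (@det_ublock _ 2 2); have /andP[/eqP <- _] := valP g.
  exact: det_O2pm.
apply/unitarymxP; rewrite /rho_mx (@tr_block_mx _ 2 2 2 2).
rewrite (@map_block_mx _ _ _ 2 2 2 2) (@mulmx_block _ 2 2 2 2 2 2).
rewrite !trmx0 !map_mx0 !(mulmx0, mul0mx, addr0, add0r).
by rewrite !(unitarymxP (U _)) -scalar_mx_block.
Qed.

Definition rho (v : 'cV[R]_7) (sigma : half_spin v) (g : calG) : N v :=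
  su4_inv sigma (rho_mx g).

End CalG.

Section Morphisms.
Variables (Gam : Type) (G : groupType).

Definition element_conjugate (r r' : Gam -> G) : Prop :=
  forall x, exists g : G, r' x = (g * r x * g^-1)%g.

Definition group_conjugate (r r' : Gam -> G) : Prop :=
  exists g : G, forall x, r' x = (g * r x * g^-1)%g.

Definition image_isog (r : Gam -> G) (K : groupType) : Prop :=
  exists phi : {multiplicative K -> G},
    injective phi /\ forall y, (exists k, phi k = y) <-> (exists x, r x = y).

End Morphisms.

(* The product of a {1,-1}-valued character chi with r. *)
Definition twist (R : realType) (v : 'cV[R]_7) (Gam : Type)
    (chi : Gam -> R[i]) (r : Gam -> N v) (x : Gam) : N v :=
  if chi x == -1 then (neg1 v * r x)%g else r x.

(* Main.v *)
Require Import Defs.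
From HB Require Import structures.
From mathcomp Require Import all_boot all_order all_algebra.
From mathcomp Require Import all_fingroup all_solvable spectral.
From mathcomp Require Import complex boolp reals ring.

(** Write a point of the group of pairs as (g1, g2), with signs d and u (the
    values of the two characters).  Each component g of such a pair is either
    real orthogonal or i times real orthogonal, so that, for the rotation
    rot90 by a quarter turn,
      - the entrywise conjugate of g is mu(g) g,
      - g rot90 = epsilon(g) rot90 g with epsilon(g) = mu(g) det(g), and tr g = 0 as soon
        as epsilon(g) = -1.
    For g1 one has (epsilon, mu) = (u, u d), for g2 one has (u d, u).

    Besides the conjugations by SU(4), N acts on its identity component SU(4) by
    A |-> P conj(A) P^-1, because an element of N outside the identity component
    exchanges the two half-spin representations, which are conjugate to each
    other (outer_conjugation).  So r and eta r are N-conjugate if and only if one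
    P in SU(4) satisfies, for all x, either P r(x) = eta(x) r(x) P or
    P conj(r(x)) = eta(x) r(x) P (inner_twist and outer_twist), and for element
    conjugacy P may depend on x.  When eta(x) = -1 the matrix diag(rot90, rot90) is of the
    first kind if d = 1, and diag(rot90, 1) is of the second kind if d = -1.

    For conjugacy of the morphisms, compare traces.  In the first case the trace
    of r vanishes off the kernel of eta; the part coming from g1 always does, so
    the condition says that g2 has trace 0 whenever epsilon(g2) = 1 and
    mu(g2) = -1.  In the second case the condition is the same for g1.  A
    component whose elements with epsilon = 1 and mu = -1 all have trace 0, that
    is, are all equal to i rot90 or - i rot90, has the image {1, -1, s, -s, a, -a,
    a s, - a s} with s = i rot90 and a reflection a, which is dihedral of order 8
    (quarter_turns_dihedral).  Conversely, in a dihedral group of order 8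
    commutators and central elements square to 1, which forces these traces to
    vanish (dihedral_quarter_turns).  In that dihedral case a and a s provide the
    missing block of P: conjugation by a multiplies g by mu(g), conjugation by
    a s multiplies g by det(g) (simf_conjugator and det_conjugator).

    The statement on half-spin representations is proved by Clifford algebra.
    For an orthonormal basis e_0, ..., e_5 of F, the products e_5 e_j (j < 5)
    generate the even Clifford algebra of F, anticommute, and square to -1.
    Conjugation by e_5 changes their signs.  Their images B_j under the half-spin
    map and the matrices - conj(B_j) satisfy the same relations and
    have the same product in order, a scalar; hence they are intertwined by a
    nonzero matrix (clifford_intertwiner), which Schur's lemma for SU(4) makes unitary. *)

Set Implicit Arguments.
Unset Strict Implicit.
Unset Printing Implicit Defensive.

(** * Images isomorphic to the dihedral group of order 8 *)

Section DihedralImage.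
Local Open Scope group_scope.

Section FiniteSubgroup.
Variables (H : groupType) (s : seq H).
(** An alias indexed by the closure proof, so that the group structure can be
    attached to it: a finite subgroup of an infinite group becomes a finGroupType
    and finite group theory applies. *)
Definition subgroup_of_seq (sG : group_closed (mem s)) := seq_sub s.
Variable sG : group_closed (mem s).
HB.instance Definition _ := SubFinite.on (subgroup_of_seq sG).
HB.instance Definition _ :=
  SubChoice_isSubGroup.Build H (mem s) (subgroup_of_seq sG) sG.
End FiniteSubgroup.

(** Both hold because the derived subgroup and the centre have order 2. *)
Lemma dihedral8_central (x y : 'D_8) :
  [~ x, y] ^+ 2 = 1 /\ ((forall z, commute x z) -> x ^+ 2 = 1).
Proof.
have iso : [set: 'D_8] \isog 'D_(2 ^ 3) by apply: isog_refl.
have [[a b] gen _] := generators_2dihedral (n := 3) isT iso.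
have [_ [_ _ o' _] _ _ /= [_ oZ _ _ _]] := dihedral2_structure (n := 3) isT gen iso.
split=> [|cx].
  have xy' : [~ x, y] \in [set: 'D_8]^`(1) by rewrite mem_commg ?inE.
  by have := order_dvdG xy'; rewrite o' order_dvdn => /eqP.
have xZ : x \in 'Z([set: 'D_8]).
  by apply/centerP; split; rewrite ?inE // => z _; apply: cx.
by have := order_dvdG xZ; rewrite oZ order_dvdn => /eqP.
Qed.

(** Equality of functions, rather than pointwise equality, lets properties of f be
    rewritten into properties of the bundled morphism. *)
Lemma multiplicative_exists (G H : groupType) (f : G -> H) :
  {morph f : x y / x * y} -> exists phi : {multiplicative G -> H}, f = phi.
Proof.
move=> fM; pose m := isMultiplicative.Build G H f fM.
by exists (HB.pack_for {multiplicative G -> H} f m).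
Qed.

Section Multiplicative.
Variables (G H : groupType) (f : {multiplicative G -> H}).

Lemma mul_morph1 : f 1 = 1.
Proof. by apply: (mulgI (f 1)); rewrite -gmulfM !mulg1. Qed.

Lemma mul_morphV x : f x^-1 = (f x)^-1.
Proof. by apply: (mulgI (f x)); rewrite -gmulfM !mulgV mul_morph1. Qed.

Lemma mul_morphX x n : f (x ^+ n) = f x ^+ n.
Proof. by elim: n => [|n IHn]; rewrite ?mul_morph1 // !expgS gmulfM IHn. Qed.

Lemma mul_morphR x y : f [~ x, y] = [~ f x, f y].
Proof. by rewrite /commg /conjg !gmulfM !mul_morphV. Qed.

End Multiplicative.

Section Image.
Variables (Gam H : groupType) (f : {multiplicative Gam -> H}).

Lemma image_isog_central (K : groupType) : image_isog f K ->
  (forall x y : K, [~ x, y] ^+ 2 = 1 /\ ((forall z, commute x z) -> x ^+ 2 = 1)) ->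
  forall x y, [~ f x, f y] ^+ 2 = 1 /\ ((forall z, commute (f x) (f z)) -> f x ^+ 2 = 1).
Proof.
move=> [phi [phi_inj im]] factsK x y.
have [_ /(_ (ex_intro _ x erefl))[a fa]] := im (f x).
have [_ /(_ (ex_intro _ y erefl))[b fb]] := im (f y).
have [E1 E2] := factsK a b; rewrite -fa -fb; split.
  by rewrite -mul_morphR -mul_morphX E1 mul_morph1.
move=> cx; rewrite -mul_morphX E2 ?mul_morph1 // => z; apply: phi_inj.
have [/(_ (ex_intro _ z erefl))[w fw] _] := im (phi z).
by rewrite !gmulfM -fw; apply: cx.
Qed.

(** The image is a finite group of order at most 8, by the normal form of its
    elements; it contains the dihedral group generated by two involutions whose
    product has order 4, and this one already has order 8. *)
Lemma image_dihedral8 (a b : Gam) :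
  f a ^+ 2 = 1 -> f b ^+ 2 = 1 -> (f a * f b) ^+ 2 != 1 -> (f a * f b) ^+ 4 = 1 ->
  (forall x, exists i j, f x = (f a * f b) ^+ i * f a ^+ j) ->
  image_isog f ('D_8)%type.
Proof.
move=> a2 b2 ab2 ab4 fE; pose c := f a * f b.
pose s : seq H :=
  undup [seq c ^+ (val i) * f a ^+ (val j) | i <- enum 'I_4, j <- enum 'I_2].
have sP y : reflect (exists x, f x = y) (y \in s).
  rewrite mem_undup; apply: (iffP allpairsP) => [[[i j] [_ _ ->]]|[x <-]] /=.
    by exists ((a * b) ^+ i * a ^+ j); rewrite gmulfM !mul_morphX gmulfM.
  have [i [j ->]] := fE x.
  exists (inord (i %% 4), inord (j %% 2)); rewrite !mem_enum /= !inordK ?ltn_mod //.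
  split=> //; rewrite {1}(divn_eq i 4) {1}(divn_eq j 2) !expgnDr.
  by rewrite !(mulnC (_ %/ _)) !expgnA -/c ab4 a2 !expg1n !mul1g.
have sG : group_closed (mem s).
  split; first by apply/sP; exists 1; rewrite mul_morph1.
  move=> _ _ /sP[x <-] /sP[y <-]; apply/sP; exists (x * y^-1).
  by rewrite gmulfM mul_morphV.
pose K : finGroupType := subgroup_of_seq sG.
have fs x : f x \in s by apply/sP; exists x.
pose A : K := Sub (f a) (fs a); pose B : K := Sub (f b) (fs b).
have cardK : (#|{: K}| <= 8)%N.
  rewrite card_seq_sub ?undup_uniq // (leq_trans (size_undup _)) //.
  by rewrite size_allpairs -!cardE !card_ord.
have AB_E n : (A * B) ^+ n = 1 <-> c ^+ n = 1.
  have E : val ((A * B) ^+ n) = c ^+ n.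
    by elim: n => // n IHn; rewrite !expgS -IHn.
  by split=> [E1|E1]; [rewrite -E E1 | apply: val_inj; rewrite E E1].
have oA : #[A] = 2.
  apply: nt_prime_order => //; first exact: val_inj.
  apply: contra_neq ab2 => A1; have a1 : f a = 1 by have := congr1 val A1.
  by rewrite -/c /c a1 mul1g.
have oB : #[B] = 2.
  apply: nt_prime_order => //; first exact: val_inj.
  apply: contra_neq ab2 => B1; have b1 : f b = 1 by have := congr1 val B1.
  by rewrite b1 mulg1.
have AB : A != B.
  apply: contra_neq ab2 => E; have <- : f a = f b by have := congr1 val E.
  by rewrite -/c -expg2 a2 expg1n.
have oC : #[A * B] = 4.
  have d4 : #[A * B] %| 4 by rewrite order_dvdn; apply/eqP/AB_E.
  have n2 : ~~ (#[A * B] %| 2).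
    by rewrite order_dvdn; apply: contra_neqN ab2 => /eqP/AB_E.
  have := @dvdn_leq _ 4 isT d4; move: d4 n2; move: #[_].
  by do 5?[case=> //].
pose G := <<[set A; B]>>%G.
have isoG : G \isog 'D_#|G| := involutions_gen_dihedral oA oB AB.
(* A group of order 4 is abelian, so two involutions in it have a product whose
   square is 1. *)
have oG : #|G| = 8.
  have d4 : 4 %| #|G|.
    by rewrite -oC order_dvdG // groupM ?mem_gen ?inE ?eqxx ?orbT.
  have n4 : #|G| != 4.
    apply: contraNneq ab2 => o4; apply/eqP/AB_E; rewrite expgMn.
      by rewrite -{1}oA -oB !expg_order mulg1.
    have /centsP cGG : abelian G by apply: (@card_p2group_abelian _ 2).
    by apply: cGG; rewrite mem_gen ?inE ?eqxx ?orbT.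
  have := leq_trans (max_card _) cardK : #|G| <= 8.
  move: d4 n4 (cardG_gt0 G); move: #|G|.
  by do 9?[case=> //].
have GT : G :=: [set: K].
  by apply/eqP; rewrite eqEcard subsetT oG cardsT.
rewrite oG GT isog_sym in isoG; have /isogP[g /injmP g_inj im_g] := isoG.
have [phi phiE] : exists phi : {multiplicative ('D_8)%type -> H}, val \o g = phi.
  by apply: multiplicative_exists => x y /=; rewrite morphM ?inE.
exists phi; split=> [x y|y].
  by rewrite -!phiE /= => /val_inj /g_inj; apply; rewrite inE.
split=> [[k <-]|]; first by apply/sP; rewrite -phiE; apply: valP.
move=> /sP ys; have : (Sub y ys : K) \in g @* 'D_8 by rewrite im_g inE.
by case/morphimP=> k _ _ E; exists k; rewrite -phiE /= -E.
Qed.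

End Image.

End DihedralImage.

Import Order.TTheory GRing.Theory Num.Theory.
Local Open Scope ring_scope.
Local Open Scope sesquilinear_scope.

(** * Matrices satisfying the Clifford relations *)

Section Intertwiner.
Variables (C : numClosedFieldType) (n m : nat).
Implicit Types B X : 'M[C]_n.+1.

Definition clifford_gens (B : nat -> 'M[C]_n.+1) :=
  (forall j, (j <= m)%N -> B j * B j = -1) /\
  (forall j k, (j <= m)%N -> (k <= m)%N -> j != k -> B j * B k = - (B k * B j)).

(** The generator B_m is kept in reserve.  The commuting involutions
    X |-> - B'_k X B_k are diagonalised one at a time: either X - B'_k X B_k is
    nonzero and intertwines B_k too, or X anti-intertwines B_k, and then
    multiplication by B_k B_m, which commutes with every other B_j, corrects the
    sign. *)
Lemma clifford_intertwiner_lt (B B' : nat -> 'M[C]_n.+1) :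
  clifford_gens B -> clifford_gens B' -> forall k, (k <= m)%N ->
  exists2 X : 'M[C]_n.+1, X != 0 & forall j, (j < k)%N -> X * B j = B' j * X.
Proof.
move=> [Bsq Banti] [Bsq' Banti']; elim=> [|k IHk] km.
  by exists 1 => //; rewrite oner_eq0.
have [X X0 XB] := IHk (ltnW km); have km' := ltnW km.
pose Y := X - B' k * X * B k.
have [Y0|Y0] := eqVneq Y 0; last first.
  exists Y => // j; rewrite ltnS leq_eqVlt => /orP[/eqP ->|jk].
    rewrite /Y mulrBl mulrBr -(mulrA _ (B k)) Bsq // mulrN1 opprK !mulrA.
    by rewrite Bsq' // mulN1r mulNr opprK addrC.
  have jm : (j < m)%N by apply: ltn_trans jk km.
  rewrite /Y mulrBl mulrBr XB //; congr (_ - _).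
  rewrite -!mulrA (Banti k j) ?gtn_eqF // 1?ltnW // mulrN mulrN (mulrA X) XB //.
  by rewrite !mulrA (Banti' j k) ?ltn_eqF // 1?ltnW // !mulNr.
have XBk : X * B k = - (B' k * X).
  by move/eqP: Y0; rewrite subr_eq0 => /eqP {1}->; rewrite -mulrA Bsq // mulrN1.
exists (X * B k * B m).
  apply: contraNneq X0 => E; have: X * B k * B m * B m * B k = 0.
    by rewrite E !mul0r.
  rewrite -(mulrA _ (B m) (B m)) Bsq // mulrN1 mulNr -mulrA Bsq // mulrN1 opprK.
  by move=> ->.
move=> j; rewrite ltnS leq_eqVlt => /orP[/eqP ->|jk].
  rewrite -[LHS]mulrA (Banti m k) ?gtn_eqF // mulrN [X in - X]mulrA {1}XBk.
  by rewrite !mulNr opprK !mulrA.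
have jm : (j < m)%N by apply: ltn_trans jk km.
rewrite -!mulrA (Banti m j) ?gtn_eqF // 1?ltnW // !mulrN !(mulrA (B k)).
rewrite (Banti k j) ?gtn_eqF // 1?ltnW // !mulNr mulrN opprK.
by rewrite !mulrA XB.
Qed.

(** The last generator is, up to the scalar c, the inverse of the product of the
    others; as c is the same on both sides, it needs no sign correction. *)
Lemma clifford_intertwiner (B B' : nat -> 'M[C]_n.+1) (c : C) :
  clifford_gens B -> clifford_gens B' ->
  \prod_(0 <= j < m.+1) B j = c%:M -> \prod_(0 <= j < m.+1) B' j = c%:M ->
  exists2 X : 'M[C]_n.+1, X != 0 & forall j, (j <= m)%N -> X * B j = B' j * X.
Proof.
move=> gB gB' PB PB'.
have [X X0 XB] := clifford_intertwiner_lt gB gB' (leqnn m).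
exists X => // j; rewrite leq_eqVlt => /orP[/eqP ->|]; last exact: XB.
have XP k : (k <= m)%N ->
    X * \prod_(0 <= j < k) B j = (\prod_(0 <= j < k) B' j) * X.
  elim: k => [|k IHk] km; first by rewrite !big_geq // mulr1 mul1r.
  by rewrite !big_nat_recr //= mulrA IHk 1?ltnW // -!mulrA XB.
move: PB PB'; rewrite !big_nat_recr //= => PB PB'.
set P' := \prod_(0 <= j < m) B' j in PB' *.
have U : P' \is a GRing.unit.
  rewrite /P'; elim: {-2}m (leqnn m) => [|k IHk] km; first by rewrite big_geq ?unitr1.
  rewrite big_nat_recr //= unitrMl ?IHk ?(ltnW km) //.
  apply/unitrP; exists (- B' k); case: gB' => Bsq' _.
  by rewrite mulNr mulrN Bsq' ?opprK // ltnW.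
have XPm := XP m (leqnn m); rewrite -/P' in XPm.
apply: (mulrI U); rewrite !mulrA -XPm -(mulrA X) PB PB'.
by rewrite -!mulmxE scalar_mxC.
Qed.

Section Volume.
Variable B : nat -> 'M[C]_n.+1.
Hypothesis gB : clifford_gens B.

Lemma volume_anti k l : (k <= l <= m)%N ->
  (\prod_(0 <= j < k) B j) * B l = (-1) ^+ k * (B l * \prod_(0 <= j < k) B j).
Proof.
case: gB => _ Banti /andP[+ lm]; elim: k => [|k IHk] kl.
  by rewrite big_geq // mulr1 !mul1r.
rewrite big_nat_recr //= -mulrA Banti ?(ltn_eqF kl) ?(leq_trans (ltnW kl)) //.
by rewrite mulrN (mulrA _ (B l) (B k)) IHk 1?ltnW // exprS mulN1r !mulNr !mulrA.
Qed.

(** With an odd number k of generators the sign is 1: their product is central. *)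
Lemma volume_comm k l : (l < k <= m.+1)%N ->
  (\prod_(0 <= j < k) B j) * B l = (-1) ^+ k.-1 * (B l * \prod_(0 <= j < k) B j).
Proof.
case: (gB) => Bsq Banti; elim: k => // k IHk /andP[]; rewrite ltnS leq_eqVlt /= => + km.
rewrite big_nat_recr //= => /orP[/eqP ->|lk].
  by rewrite {1}volume_anti ?leqnn // !mulrA.
rewrite -mulrA Banti ?gtn_eqF // ?(leq_trans (ltnW lk)) //.
rewrite mulrN (mulrA _ (B l) (B k)) IHk ?lk 1?ltnW // -!mulNr.
by case: (k) lk => // k' _; rewrite exprS mulN1r /= !mulrA.
Qed.

(** Adding the factor B_k contributes k signs for moving it through the previous
    product and one sign for its square, whence the binomial exponent. *)
Lemma volume_sqr k : (k <= m.+1)%N ->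
  (\prod_(0 <= j < k) B j) * (\prod_(0 <= j < k) B j) = (-1) ^+ 'C(k.+1, 2).
Proof.
case: (gB) => Bsq Banti; elim: k => [|k IHk] km; first by rewrite big_geq // mulr1.
rewrite big_nat_recr //= binS bin1 exprD -IHk 1?ltnW //.
have := volume_anti (k := k) (l := k); rewrite leqnn => /(_ km).
move: (\prod_(0 <= j < k) B j) => P PB.
have BP : B k * P = (-1) ^+ k * (P * B k) by rewrite PB mulrA -expr2 sqrr_sign mul1r.
have -> : P * B k * (P * B k) = (-1) ^+ k * (P * P * (B k * B k)).
  by rewrite -mulrA (mulrA (B k)) BP !mulrA (commr_sign P k).
by rewrite Bsq // mulrN1 mulrN exprS mulN1r mulrN -(commr_sign (P * P)).
Qed.

End Volume.

End Intertwiner.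

(** * Schur's lemma for SU(4) *)

Section SpecialUnitary.
Variable C : numClosedFieldType.
Local Notation SU n := (fun A : 'M[C]_n => A \is unitarymx /\ \det A = 1).

Lemma SU4_perm (s : 'S_4) : ~~ odd_perm s -> SU 4 (perm_mx s).
Proof.
move=> es; split; last by rewrite det_perm (negPf es).
by apply/unitarymxP; rewrite tr_perm_mx map_perm_mx -perm_mxM mulgV perm_mx1.
Qed.

Lemma SU4_signs (a b : 'I_4) : a != b ->
  SU 4 (diag_mx (\row_i (-1) ^+ ((i == a) || (i == b)))).
Proof.
move=> ab; split.
  apply/unitarymxP; rewrite tr_diag_mx map_diag_mx mulmx_diag -diag_const_mx.
  congr diag_mx; apply/rowP=> i; rewrite !mxE rmorphXn rmorphN rmorph1.
  by rewrite -expr2 sqrr_sign.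
rewrite det_diag (bigD1 a) //= (bigD1 b) 1?eq_sym //= big1 => [|i /andP[ia ib]].
  by rewrite !mxE !eqxx orbT mulr1 mulrNN mulr1.
by rewrite mxE (negPf ia) (negPf ib).
Qed.

Lemma ord4_third (i j : 'I_4) : exists2 k, k != i & k != j.
Proof.
have : (0 < #|~: [set i; j]|)%N.
  by rewrite cardsCs setCK card_ord subn_gt0 cards2; case: eqP.
by case/card_gt0P=> k; rewrite !inE negb_or => /andP[]; exists k.
Qed.

(** Diagonal matrices with two entries -1 force M to be diagonal, and even
    permutation matrices force its diagonal entries to agree; dimension 4 leaves
    room for the third index that makes the determinants equal to 1. *)
Lemma SU4_commutant (M : 'M[C]_4) :
  (forall A, SU 4 A -> M *m A = A *m M) -> exists c, M = c%:M.
Proof.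
move=> comm.
have off i j : i != j -> M i j = 0.
  move=> ij; have [k ki kj] := ord4_third i j.
  have ik : i != k by rewrite eq_sym.
  have /matrixP/(_ i j) := comm _ (SU4_signs ik); rewrite mul_mx_diag mul_diag_mx !mxE eqxx.
  rewrite (eq_sym j i) (negPf ij) (eq_sym j k) (negPf kj) expr0 mulr1 expr1 mulN1r.
  by move/eqP; rewrite -addr_eq0 -mulr2n mulrn_eq0 => /eqP.
have diag i j : M i i = M j j.
  have [-> //|ij] := eqVneq i j.
  have [k ki kj] := ord4_third i j.
  pose s := (tperm i k * tperm i j)%g.
  have sj : s j = i by rewrite permM [tperm i k j]tpermD // tpermR.
  have es : ~~ odd_perm s by rewrite odd_permM !odd_tperm ij eq_sym ki.
  have /matrixP/(_ j i) := comm _ (SU4_perm es).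
  rewrite -row_permE -{1}[s]invgK -col_permE !mxE sj => <-; congr (M _ _).
  by apply: (@perm_inj _ s); rewrite permKV sj.
exists (M 0 0); apply/matrixP=> i j; rewrite !mxE.
have [<-|ij] := eqVneq i j; first by rewrite mulr1n (diag i 0).
by rewrite mulr0n off.
Qed.

(** By Schur's lemma X^* X is a positive scalar, so that X is a multiple of a
    unitary matrix; a fourth root then corrects the determinant. *)
Lemma SU4_normalize (X : 'M[C]_4) : X != 0 ->
  (forall A, SU 4 A -> (X ^t* *m X) *m A = A *m (X ^t* *m X)) ->
  exists c, SU 4 (c *: X).
Proof.
move=> X0 /SU4_commutant[c Xc].
have c_ge0 : 0 <= c.
  have /matrixP/(_ 0 0) := Xc; rewrite !mxE eqxx mulr1n => <-.
  by apply: sumr_ge0 => i _; rewrite !mxE mulrC mul_conjC_ge0.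
have c0 : c != 0.
  apply: contraNneq X0 => c0; apply/eqP/matrixP=> i j; rewrite mxE.
  have /matrixP/(_ j j) := Xc; rewrite c0 !mxE mul0rn => /eqP.
  rewrite psumr_eq0 => [/allP/(_ i (mem_index_enum _))|k _]; last first.
    by rewrite !mxE mulrC mul_conjC_ge0.
  by rewrite !mxE mulrC mul_conjC_eq0 => /eqP.
pose U := (sqrtC c)^-1 *: X.
have sc0 : sqrtC c != 0 by rewrite sqrtC_eq0.
have UU : U ^t* *m U = 1%:M.
  rewrite /U [(_ *: X)^T]linearZ /= map_mxZ -scalemxAr -scalemxAl scalerA Xc.
  rewrite /= geC0_conj ?invr_ge0 ?sqrtC_ge0 // -invfM -expr2 sqrtCK.
  by rewrite scale_scalar_mx mulVf.
have dU : (\det U)^* * \det U = 1.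
  by rewrite -[RHS](det1 _ 4) -UU det_mulmx det_map_mx det_tr.
have dU0 : \det U != 0 by apply: contra_eq_neq dU => ->; rewrite mulr0 eq_sym oner_eq0.
pose z := 4.-root (\det U)^-1.
have z4 : z ^+ 4 = (\det U)^-1 by rewrite rootCK.
have z1 : `|z| = 1.
  apply/eqP; rewrite -(pexpr_eq1 (n := 4)) // -normrX z4 normfV invr_eq1.
  by rewrite -(pexpr_eq1 (n := 2)) // normCK mulrC dU.
exists (z / sqrtC c).
rewrite -scalerA -/U; split; last by rewrite detZ z4 mulVf.
apply/unitarymxP; rewrite [(_ *: U)^T]linearZ /= map_mxZ -scalemxAr -scalemxAl scalerA.
by rewrite mulrC -normCK z1 expr1n scale1r (mulmx1C UU).
Qed.

End SpecialUnitary.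

(** * Orthonormal frames adapted to the line *)

(** The block matrix [1, 2u; u^T, 1] has two block triangular factorisations, one for
    each Schur complement. *)
Lemma det_householder (F : comNzRingType) n (u : 'cV[F]_n) : u^T *m u = 1%:M ->
  \det (1%:M - 2%:R *: (u *m u^T)) = -1.
Proof.
move=> uu; pose A := block_mx 1%:M (2%:R *: u) u^T 1%:M : 'M[F]_(n + 1).
have E1 : A = block_mx 1%:M 0 u^T 1%:M *m
    block_mx 1%:M (2%:R *: u) 0 (1%:M - 2%:R%:M).
  rewrite mulmx_block !mul1mx !mulmx1 !mulmx0 !mul0mx !addr0 -scalemxAr uu.
  by rewrite scale_scalar_mx mulr1 addrC subrK.
have E2 : A = block_mx 1%:M (2%:R *: u) 0 1%:M *m
    block_mx (1%:M - 2%:R *: (u *m u^T)) 0 u^T 1%:M.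
  rewrite mulmx_block !mul1mx !mulmx1 !mulmx0 !mul0mx !add0r.
  by rewrite -scalemxAl subrK.
have := congr1 determinant E1; rewrite {1}E2 !det_mulmx !det_lblock !det_ublock.
rewrite !det1 !(mul1r, mulr1) => ->; rewrite det_mx11 !mxE eqxx /=.
by rewrite !mulr1n -[2%:R]/(1 + 1) opprD addrA subrr add0r.
Qed.

Section Dot.
Variables (R : realType) (n : nat).
Implicit Types u w : 'cV[R]_n.

Lemma dotvE u w : dotv u w = \sum_i u i 0 * w i 0.
Proof. by rewrite /dotv mxE; apply: eq_bigr => i _; rewrite mxE. Qed.

Lemma dotvC u w : dotv u w = dotv w u.
Proof. by rewrite !dotvE; apply: eq_bigr => i _; rewrite mulrC. Qed.

Lemma dotvDl u u' w : dotv (u + u') w = dotv u w + dotv u' w.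
Proof. by rewrite /dotv linearD /= mulmxDl mxE. Qed.

Lemma dotvZl a u w : dotv (a *: u) w = a * dotv u w.
Proof. by rewrite /dotv linearZ /= -scalemxAl mxE. Qed.

Lemma dotvZr a u w : dotv u (a *: w) = a * dotv u w.
Proof. by rewrite dotvC dotvZl dotvC. Qed.

Lemma dotv_gt0 u : u != 0 -> 0 < dotv u u.
Proof.
move=> u0; rewrite lt_def dotvE; apply/andP; split; last first.
  by apply: sumr_ge0 => i _; rewrite -expr2 sqr_ge0.
apply: contraNneq u0 => /eqP; rewrite psumr_eq0 => [/allP E|i _]; last first.
  by rewrite -expr2 sqr_ge0.
apply/eqP/matrixP=> i j; rewrite ord1 mxE.
by have /= := E i (mem_index_enum _); rewrite -expr2 expf_eq0 => /eqP.
Qed.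

Lemma unit_multiple u : u != 0 -> exists2 c, c != 0 & dotv (c *: u) (c *: u) = 1.
Proof.
move=> /dotv_gt0 u0; exists (Num.sqrt (dotv u u))^-1.
  by rewrite invr_eq0 sqrtr_eq0 -ltNge.
by rewrite dotvZl dotvZr mulrA -invfM -expr2 sqr_sqrtr ?mulVf ?gt_eqF ?ltW.
Qed.

Lemma dotv_mx u : dotv u u = 1 -> u^T *m u = 1%:M.
Proof. by move=> u1; apply/matrixP=> i j; rewrite !ord1 [RHS]mxE. Qed.

Lemma householder_vec u w : dotv u u = 1 -> dotv w w = 1 ->
  exists H : 'M[R]_n, H^T *m H = 1%:M /\ H *m u = w.
Proof.
move=> u1 w1; have [->|neq] := eqVneq w u.
  by exists 1%:M; rewrite trmx1 !mul1mx.
have d0 : w - u != 0 by rewrite subr_eq0.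
have [c c0 c1] := unit_multiple d0.
have [d dd dE] : exists2 d, d^T *m d = 1%:M & d = c *: (w - u).
  by exists (c *: (w - u)) => //; apply: dotv_mx.
exists (1%:M - 2%:R *: (d *m d^T)).
have sym : (1%:M - 2%:R *: (d *m d^T))^T = 1%:M - 2%:R *: (d *m d^T).
  by rewrite linearB linearZ /= trmx1 trmx_mul trmxK.
split.
  have PP : (d *m d^T) *m (d *m d^T) = d *m d^T.
    by rewrite -mulmxA (mulmxA d^T) dd mul1mx.
  rewrite sym; move: (d *m d^T) PP => P PP.
  rewrite mulmxBl mul1mx mulmxBr mulmx1 -scalemxAl -scalemxAr PP scalerA.
  rewrite -addrA -opprD -scaleNr -!scalerDl.
  rewrite (_ : 2%:R + (2%:R + - (2%:R * 2%:R)) = 0 :> R) ?scale0r ?subr0 //; ring.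
rewrite mulmxBl mul1mx -scalemxAl -mulmxA.
have -> : d^T *m u = (dotv d u)%:M.
  by apply/matrixP=> i j; rewrite !ord1 [RHS]mxE eqxx mulr1n.
rewrite mul_mx_scalar scalerA dE scalerA dotvZl.
have -> : 2%:R * (c * dotv (w - u) u) * c = -1.
  have D : dotv (w - u) (w - u) = 2%:R - 2%:R * dotv w u.
    rewrite dotvDl !(dotvC _ (w - u)) !dotvDl -scaleN1r !dotvZl !dotvZr w1 u1.
    by rewrite (dotvC u w); ring.
  move: c1; rewrite dotvZl dotvZr D dotvDl -scaleN1r dotvZl u1 => E.
  by rewrite -[in RHS]E; ring.
by rewrite scaleN1r opprK addrC subrK.
Qed.

End Dot.

Section Frame.
Variables (R : realType) (v : 'cV[R]_7).

(** An orthonormal basis e_0, ..., e_6 of R^7 whose last vector spans the line; the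
    first six then span the hyperplane F.  Indexing by nat avoids ordinals in the
    Clifford computations. *)
Record frame (e : nat -> 'cV[R]_7) : Prop := Frame {
  frame_dot : forall j k, (j <= 6)%N -> (k <= 6)%N -> dotv (e j) (e k) = (j == k)%:R;
  frame_exp : forall u, u = \sum_(0 <= j < 7) dotv u (e j) *: e j;
  frame_line : exists2 c, c != 0 & v = c *: e 6
}.

Lemma frame_exists : v != 0 -> exists e, frame e.
Proof.
move=> v0; have [c c0 c1] := unit_multiple v0.
have [] := @householder_vec _ _ (delta_mx (inord 6) 0 : 'cV[R]_7) (c *: v) _ c1.
  by rewrite /dotv trmx_delta mul_delta_mx mxE eqxx.
move=> H [HH Hv]; have HH' := mulmx1C HH.
exists (fun j => H *m delta_mx (inord j) 0); split.
- move=> j k j6 k6; rewrite /dotv trmx_mul -mulmxA (mulmxA _ H) HH mul1mx trmx_delta.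
  rewrite mul_delta_mx_cond -(inj_eq val_inj) /= !inordK // mulrb.
  by case: eqP; rewrite ?mxE ?eqxx.
- move=> u; rewrite -{1}[u]mul1mx -HH' -mulmxA.
  rewrite {1}[H^T *m u]matrix_sum_delta linear_sum /= big_mkord.
  apply: eq_bigr => i _; rewrite big_ord1 -scalemxAr.
  have -> : inord i = i by apply: val_inj; rewrite /= inordK.
  rewrite (_ : ord0 = 0) //; congr (_ *: _).
  by rewrite dotvC /dotv trmx_mul trmx_delta -mulmxA -rowE [RHS]mxE.
by exists c^-1; rewrite ?invr_eq0 // Hv scalerA mulVf // scale1r.
Qed.

End Frame.

(** * The even Clifford algebra of the hyperplane *)

Section CliffordFrame.
Variables (R : realType) (v : 'cV[R]_7) (e : nat -> 'cV[R]_7).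
Hypothesis fe : frame v e.
Local Notation Cl := (clifford R 7).
Local Notation E j := (iota_cl (e j) : Cl).
Local Notation ev := (even_clifford_perp v).
Implicit Types (x y : Cl) (u w : 'cV[R]_7).

Lemma frame_sqr j : (j <= 6)%N -> E j * E j = -1.
Proof. by move=> j6; rewrite iota_sqr (frame_dot fe) // eqxx scaleN1r. Qed.

Lemma frame_anti j k : (j <= 6)%N -> (k <= 6)%N -> j != k -> E j * E k = - (E k * E j).
Proof.
move=> j6 k6 /negPf jk; apply/eqP; rewrite -addr_eq0 iota_anticomm.
by rewrite (frame_dot fe) // jk mulr0 oppr0 scale0r.
Qed.

Lemma frame_perp j : (j < 6)%N -> dotv (e j) v = 0.
Proof.
move=> j6; have [c _ ->] := frame_line fe.
by rewrite dotvZr (frame_dot fe) ?ltn_eqF ?mulr0 // ltnW.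
Qed.

Lemma frame_exp_perp u : dotv u v = 0 -> u = \sum_(0 <= j < 6) dotv u (e j) *: e j.
Proof.
have [c c0 ->] := frame_line fe; rewrite dotvZr => /eqP.
rewrite mulf_eq0 (negPf c0) /= => /eqP u6.
by rewrite {1}(frame_exp fe u) big_nat_recr //= u6 scale0r addr0.
Qed.

Section Induction.
Variable Q : Cl -> Prop.
Hypotheses (Q1 : Q 1) (Qlin : forall a x y, Q x -> Q y -> Q (a *: x + y))
  (Qmul : forall x y, Q x -> Q y -> Q (x * y)).

Let Q0 : Q 0.
Proof. by have := Qlin (-1) Q1 Q1; rewrite scaleN1r addNr. Qed.

Let QZ a x : Q x -> Q (a *: x).
Proof. by move=> Qx; rewrite -[_ *: _]addr0; apply: Qlin. Qed.

(** A product u u' of two vectors is - (u e_5) (e_5 u'), and u e_5 is - e_5 u up to a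
    scalar; so the products e_5 e_j generate.  It is used with m = 6, for the
    hyperplane, and with m = 7, for the whole space. *)
Lemma pair_ind m : (5 < m <= 7)%N ->
  (forall j, (j < m)%N -> j != 5 -> Q (E 5 * E j)) ->
  forall u u', u = \sum_(0 <= j < m) dotv u (e j) *: e j ->
    u' = \sum_(0 <= j < m) dotv u' (e j) *: e j -> Q (iota_cl u * iota_cl u').
Proof.
move=> /andP[m5 m7] Qj.
have Q5 u : u = \sum_(0 <= j < m) dotv u (e j) *: e j -> Q (E 5 * iota_cl u).
  move=> ->; rewrite linear_sum mulr_sumr big_mkord.
  apply: big_ind => [//|x y Qx Qy|j _]; first by rewrite -[x]scale1r; apply: Qlin.
  rewrite linearZ -scalerAr; apply: QZ.
  have [->|j5] := eqVneq (j : nat) 5; last by apply: Qj.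
  by rewrite frame_sqr // -scaleN1r; apply: QZ.
move=> u u' Du Du'.
have -> : iota_cl u * iota_cl u' = (-1) *: ((iota_cl u * E 5) * (E 5 * iota_cl u')).
  by rewrite mulrA -(mulrA _ (E 5) (E 5)) frame_sqr // mulrN1 mulNr scaleN1r opprK.
apply/QZ/Qmul; last exact: Q5.
have -> : iota_cl u * E 5 = (-1) *: (E 5 * iota_cl u) + (- (2%:R * dotv u (e 5))) *: 1.
  by rewrite -iota_anticomm scaleN1r addrC addrK.
by apply: Qlin; [exact: Q5 | exact: QZ].
Qed.

Lemma ev_ind : (forall j, (j < 5)%N -> Q (E 5 * E j)) -> forall x, ev x -> Q x.
Proof.
move=> Qj x; elim=> [//|u w uv wv|a y z _ Qy _ Qz|y z _ Qy _ Qz].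
- apply: (@pair_ind 6) => //; try exact: frame_exp_perp.
  by move=> j; rewrite ltnS leq_eqVlt => /orP[/eqP ->|/Qj].
- exact: Qlin.
exact: Qmul.
Qed.

End Induction.

Lemma ev_gen j : (j < 6)%N -> ev (E 5 * E j).
Proof. by move=> j6; apply: EvenGen; apply: frame_perp. Qed.

Lemma evZ a x : ev x -> ev (a *: x).
Proof.
move=> ex; rewrite -[_ *: _]addr0; apply: EvenLin => //.
rewrite -[0](addNr 1) -scaleN1r; apply: EvenLin; exact: EvenOne.
Qed.

Lemma evD x y : ev x -> ev y -> ev (x + y).
Proof. by move=> ex ey; rewrite -[x]scale1r; apply: EvenLin. Qed.

Lemma evN x : ev x -> ev (- x).
Proof. by rewrite -scaleN1r; apply: evZ. Qed.

(** Conjugation by e_5, since the inverse of e_5 is - e_5; on the even Clifford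
    algebra of F it is induced by the reflection of F along e_5. *)
Definition cl_reflect x : Cl := - (E 5 * x * E 5).

Lemma reflectE x : E 5 * x = cl_reflect x * E 5.
Proof. by rewrite /cl_reflect mulNr -(mulrA _ (E 5) (E 5)) frame_sqr // mulrN1 opprK. Qed.

Lemma reflectE' x : x * E 5 = E 5 * cl_reflect x.
Proof. by rewrite /cl_reflect mulrN !mulrA frame_sqr // mulN1r mulNr opprK. Qed.

Lemma reflect1 : cl_reflect 1 = 1.
Proof. by rewrite /cl_reflect mulr1 frame_sqr // opprK. Qed.

Lemma reflect_lin a x y : cl_reflect (a *: x + y) = a *: cl_reflect x + cl_reflect y.
Proof. by rewrite /cl_reflect mulrDr mulrDl opprD scalerN -scalerAr -scalerAl. Qed.

Lemma reflectM x y : cl_reflect (x * y) = cl_reflect x * cl_reflect y.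
Proof.
rewrite /cl_reflect mulrNN !mulrA -(mulrA _ (E 5) (E 5)) frame_sqr //.
by rewrite mulrN1 !mulNr.
Qed.

(** e_5 anticommutes with e_j.  This sign is what conjugates a half-spin
    representation into the complex conjugate one. *)
Lemma reflect_gen j : (j < 5)%N -> cl_reflect (E 5 * E j) = - (E 5 * E j).
Proof.
move=> j5; rewrite /cl_reflect mulrA frame_sqr // mulN1r mulNr opprK frame_anti ?opprK //.
  exact: leq_trans (ltnW j5) _.
  by rewrite gtn_eqF.
Qed.

Lemma gen_mul j k : (j < 5)%N -> (k <= 6)%N -> (E 5 * E j) * (E 5 * E k) = E j * E k.
Proof.
move=> j5 k6; rewrite (frame_anti (j := 5)) // ?gtn_eqF //; last first.
  exact: leq_trans (ltnW j5) _.
by rewrite mulNr -mulrA (mulrA (E 5) (E 5)) frame_sqr // mulN1r mulrN opprK.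
Qed.

Lemma ev_reflect x : ev x -> ev (cl_reflect x).
Proof.
elim/ev_ind: x / => [|a x y|x y|j j5].
- rewrite reflect1; exact: EvenOne.
- rewrite reflect_lin; exact: EvenLin.
- rewrite reflectM; exact: EvenMul.
by rewrite reflect_gen //; apply/evN/ev_gen/ltnW.
Qed.

Lemma ev_comm6 x : ev x -> E 6 * x = x * E 6.
Proof.
elim/ev_ind: x / => [|a x y Ex Ey|x y Ex Ey|j j5].
- by rewrite mulr1 mul1r.
- by rewrite mulrDr mulrDl -scalerAr -scalerAl Ex Ey.
- by rewrite mulrA Ex -!mulrA Ey.
have j6 : (j <= 6)%N by exact: leq_trans (ltnW j5) _.
have j6' : 6 != j by rewrite gtn_eqF // ltnW.
rewrite mulrA (frame_anti (j := 6) (k := 5)) // mulNr -!mulrA.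
by rewrite (frame_anti (j := 6) (k := j)) // mulrN opprK.
Qed.

(** A lift of the half turn in the plane of e_6 and e_5.  It reverses the line, and
    so represents the component of N other than the identity component. *)
Definition turn : Cl := E 6 * E 5.

Lemma turn_sqr : turn * turn = -1.
Proof.
rewrite /turn mulrA -(mulrA (E 6)) (frame_anti (j := 5) (k := 6)) // mulrN mulrA.
by rewrite frame_sqr // mulN1r opprK frame_sqr.
Qed.

Lemma turn6 : E 6 * turn = - (turn * E 6).
Proof.
by rewrite /turn -mulrA (frame_anti (j := 5) (k := 6)) // mulrN opprK.
Qed.

Lemma turn_ev x : ev x -> x * turn = turn * cl_reflect x.
Proof. by move=> ex; rewrite /turn mulrA -ev_comm6 // -!mulrA -reflectE'. Qed.

(** The even Clifford algebra of R^7 splits as the sum of the part that commutes with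
    e_6, which is the even Clifford algebra of F, and of a part that anticommutes
    with e_6. *)
Definition even_split x := exists a b, [/\ ev a, ev b & x = a + turn * b].

Lemma even_split_lin a x y : even_split x -> even_split y -> even_split (a *: x + y).
Proof.
move=> [p [q [ep eq ->]]] [p' [q' [ep' eq' ->]]].
exists (a *: p + p'), (a *: q + q'); split; try exact: EvenLin.
by rewrite scalerDr mulrDr -scalerAr addrACA.
Qed.

Lemma even_split_mul x y : even_split x -> even_split y -> even_split (x * y).
Proof.
move=> [p [q [ep eq ->]]] [p' [q' [ep' eq' ->]]].
exists (p * p' - cl_reflect q * q'), (cl_reflect p * q' + q * p'); split.
- by apply: evD; [|apply: evN]; apply: EvenMul => //; apply: ev_reflect.
- by apply: evD; apply: EvenMul => //; apply: ev_reflect.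
have E1 : p * (turn * q') = turn * (cl_reflect p * q').
  by rewrite mulrA turn_ev // -mulrA.
have E2 : turn * q * (turn * q') = - (cl_reflect q * q').
  rewrite -mulrA (mulrA q) turn_ev // -[turn * cl_reflect q * q']mulrA mulrA.
  by rewrite turn_sqr mulN1r.
rewrite mulrDl !mulrDr E1 E2 -!addrA; congr (_ + _).
by rewrite addrA addrC -mulrA.
Qed.

Lemma ev_even_split x : ev x -> even_split x.
Proof.
move=> ex; exists x, 0; split; rewrite ?mulr0 ?addr0 //.
by rewrite -(scale0r 1); apply/evZ/EvenOne.
Qed.

Lemma even_split_pair u w : even_split (iota_cl u * iota_cl w).
Proof.
apply: (@pair_ind even_split _ _ _ 7) => //; try exact: frame_exp fe _.
- exact/ev_even_split/EvenOne.
- exact: even_split_lin.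
- exact: even_split_mul.
move=> j; rewrite ltnS leq_eqVlt => /orP[/eqP -> _|j6 _]; last exact/ev_even_split/ev_gen.
exists 0, (-1); split; first by rewrite -(scale0r 1); apply/evZ/EvenOne.
  exact/evN/EvenOne.
by rewrite add0r mulrN1 frame_anti.
Qed.

Lemma even_split_spin (x : spin R 7) : even_split x.
Proof.
case: x => x /=; rewrite /spin_val /= => /asboolP[s [_ + ->]].
have [m] := ubnP (size s); elim: m s => // m IHm [|u [|w s]] //= sm es.
  by rewrite big_nil; apply/ev_even_split/EvenOne.
rewrite !big_cons mulrA; apply: even_split_mul; first exact: even_split_pair.
by apply: IHm; rewrite ?negbK // in es *; rewrite -ltnS ltnW.
Qed.

(** Elements of the second summand anticommute with e_6, so that only 0 among them
    commutes with e_6. *)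
Lemma even_split_comm6 x : even_split x -> E 6 * x = x * E 6 -> ev x.
Proof.
move=> [a [b [ea eb ->]]]; rewrite mulrDr mulrDl (ev_comm6 ea) => /addrI.
rewrite mulrA turn6 mulNr -(mulrA turn (E 6)) -(mulrA turn b) (ev_comm6 eb) => /eqP.
rewrite eq_sym -addr_eq0 -mulr2n => /eqP E0.
have : (2%:R : R) *: (turn * (b * E 6)) = 0 by rewrite scaler_nat.
move/eqP; rewrite scaler_eq0 pnatr_eq0 /= mulrA => /eqP E1.
have -> : turn * b = 0.
  have : turn * b * E 6 * E 6 = 0 by rewrite E1 mul0r.
  by rewrite -mulrA frame_sqr // mulrN1 => /eqP; rewrite oppr_eq0 => /eqP.
by rewrite addr0.
Qed.

End CliffordFrame.

(** * The group N and its identity component *)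

(** A unit vector acts by 2 u u^T - 1, the opposite of a reflection, which has
    determinant 1 in odd dimension. *)
Lemma det_spin_cover (R : realType) n (x : spin R n) : odd n -> \det (spin_cover x) = 1.
Proof.
move=> odd_n.
have [M Mx detM] : exists2 M,
    forall u, spin_val x * iota_cl u / spin_val x = iota_cl (M *m u)
    & \det M = 1.
  case: x => x /=; rewrite /spin_val /= => /asboolP[s [Hs _ ->]].
  have [_ ->] := spin_prodV Hs; elim: s Hs => [|w s IHs] Hs.
    by exists 1%:M; rewrite ?det1 // => u; rewrite !big_nil mul1r mulr1 mul1mx.
  have [M ME detM] := IHs (fun w ws => Hs w (mem_behead (s := _ :: s) ws)).
  have w1 := Hs w (mem_head w s).
  exists ((2%:R *: (w *m w^T) - 1%:M) *m M) => [u|].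
    rewrite map_cons rev_cons -cats1 big_cat big_seq1 big_cons !mulrA.
    rewrite -(mulrA (iota_cl w)) -(mulrA (iota_cl w)) ME reflE //; congr iota_cl.
    rewrite -mulmxA mulmxBl mul1mx -scalemxAl -scalerA; congr (_ *: _ - _).
    rewrite -mulmxA [w^T *m _]mx11_scalar mul_mx_scalar; congr (_ *: _).
  rewrite det_mulmx detM mulr1 -opprB -scaleN1r detZ det_householder; last exact: dotv_mx.
  by rewrite -signr_odd odd_n expr1 mulrNN mulr1.
suff -> : spin_cover x = M by [].
apply/matrixP=> i j; have /iota_inj/matrixP/(_ i 0) :
    iota_cl (spin_cover x *m delta_mx j 0) = iota_cl (M *m delta_mx j 0).
  by rewrite -coverE -Mx.
by rewrite -!colE !mxE.
Qed.

Section N0.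
Variables (R : realType) (v : 'cV[R]_7).
Hypothesis v0 : v != 0.
Implicit Types (x y : N v).

Let vv0 : dotv v v != 0.
Proof. by rewrite gt_eqF ?dotv_gt0. Qed.

(** The sign by which x acts on the line is the determinant of its action on F, as
    the total determinant is 1. *)
Lemma N_line x : exists2 s : bool, spin_cover x *m v = (-1) ^+ s *: v & N0 v x = ~~ s.
Proof.
have /vlineP[a Ea] : stab_line v x := valP x.
have a1 : a ^+ 2 = 1.
  have := coverE x v; rewrite Ea linearZ /= => E.
  have : (a *: iota_cl v) * (a *: iota_cl v) = iota_cl v * iota_cl v.
    rewrite -E !mulrA divrK ?spin_val_unit // -(mulrA (spin_val x)) iota_sqr.
    by rewrite -scalerAr mulr1 -scalerAl divrr ?spin_val_unit.
  rewrite -scalerAl -scalerAr scalerA iota_sqr scalerA => /eqP.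
  rewrite -subr_eq0 -scalerBl scaler_eq0 oner_eq0 orbF subr_eq0 mulrN.
  by rewrite eqr_opp -{2}[dotv v v]mul1r (inj_eq (mulIf vv0)) -expr2 => /eqP.
have [s as_] : exists s : bool, a = (-1) ^+ s.
  move/eqP: a1; rewrite sqrf_eq1 => /orP[] /eqP ->; first by exists false.
  by exists true.
exists s; first by rewrite Ea as_.
have pp : proj_line v *m v = v.
  rewrite /proj_line -scalemxAl -mulmxA [v^T *m v]mx11_scalar mul_mx_scalar.
  by rewrite scalerA -/(dotv v v) mulVf ?scale1r.
have cp : spin_cover x *m proj_line v = (-1) ^+ s *: proj_line v.
  by rewrite /proj_line -scalemxAr mulmxA Ea -scalemxAl scalerA mulrC -scalerA as_.
have d1 := det_spin_cover x isT.
have [c c0 c1] := unit_multiple v0.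
have pE : proj_line v = (c *: v) *m (c *: v)^T.
  rewrite /proj_line linearZ /= -scalemxAl -scalemxAr scalerA; congr (_ *: _).
  by apply: (mulIf vv0); rewrite mulVf // -mulrA -dotvZr -dotvZl c1.
rewrite /N0 mulmxBr mulmx1 cp; case: s {as_} cp => cp.
  rewrite expr1 scaleN1r opprK -addrA -mulr2n -scaler_nat.
  have -> : spin_cover x + 2%:R *: proj_line v =
      spin_cover x *m (1%:M - 2%:R *: proj_line v).
    by rewrite mulmxBr mulmx1 -scalemxAr cp scaleN1r scalerN opprK.
  rewrite det_mulmx d1 mul1r pE det_householder; last exact: dotv_mx.
  by apply/eqP=> /eqP; rewrite eqNr oner_eq0.
by rewrite expr0 scale1r subrK d1 eqxx.
Qed.

Lemma N0P x : reflect (spin_cover x *m v = v) (N0 v x).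
Proof.
apply: (iffP idP); have [s -> ->] := N_line x; case: s => //= E.
  by rewrite scale1r.
move/eqP: E; rewrite expr1 scaleN1r eq_sym -addr_eq0 -mulr2n -scaler_nat.
by rewrite scaler_eq0 pnatr_eq0 (negPf v0).
Qed.

Lemma N0PN x : ~~ N0 v x -> spin_cover x *m v = - v.
Proof. by have [s -> ->] := N_line x; case: s; rewrite // expr1 scaleN1r. Qed.

Lemma N_valM x y : spin_val (N_val (x * y)%g) = spin_val x * spin_val y.
Proof. exact: spin_valM. Qed.

Lemma N_coverM x y : spin_cover (N_val (x * y)%g) = spin_cover x *m spin_cover y.
Proof. exact: coverM. Qed.

Lemma N0_M x y : N0 v x -> N0 v y -> N0 v (x * y)%g.
Proof. by move=> /N0P Ex /N0P Ey; apply/N0P; rewrite N_coverM -mulmxA Ey. Qed.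

Lemma N0_V x : N0 v x -> N0 v (x^-1)%g.
Proof.
move=> /N0P Ex; apply/N0P.
have : spin_cover (N_val (x^-1 * x)%g) *m v = v by rewrite mulVg Defs.cover1 mul1mx.
by rewrite N_coverM -mulmxA Ex.
Qed.

Lemma N0_MN x y : ~~ N0 v x -> ~~ N0 v y -> N0 v (x * y)%g.
Proof.
move=> /N0PN Ex /N0PN Ey; apply/N0P.
by rewrite N_coverM -mulmxA Ey mulmxN Ex opprK.
Qed.

Lemma N0_VN x : ~~ N0 v x -> ~~ N0 v (x^-1)%g.
Proof. by apply: contra => /N0_V; rewrite invgK. Qed.

Lemma N0_J x y : N0 v x -> N0 v (y * x * y^-1)%g.
Proof.
have [yN|yN] := boolP (N0 v y) => xN.
  by apply: (N0_M _ (N0_V yN)); apply: (N0_M yN xN).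
apply/N0P; have := N0PN (N0_VN yN); move: yN xN => /N0PN Ey /N0P Ex Ey'.
by rewrite !N_coverM -!mulmxA Ey' !mulmxN Ex Ey opprK.
Qed.

Lemma val_neg1 : spin_val (neg1 v) = -1.
Proof. by rewrite /spin_val /N_val !SubK. Qed.

Lemma N0_neg1 : N0 v (neg1 v).
Proof.
apply/N0P; apply: iota_inj; rewrite -coverE val_neg1 invrN1 mulrN1 mulN1r.
exact: opprK.
Qed.

Section WithFrame.
Variables (e : nat -> 'cV[R]_7) (fe : frame v e).
Local Notation E j := (iota_cl (e j) : clifford R 7).

(** An element fixing v commutes with v in the Clifford algebra, and
    even_split_comm6 applies. *)
Lemma N0_ev x : N0 v x -> even_clifford_perp v (spin_val x).
Proof.
move=> /N0P Ex; apply: (even_split_comm6 fe); first exact: even_split_spin.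
have [c c0 vE] := frame_line fe.
have E6 : iota_cl v = c *: E 6 by rewrite {1}vE linearZ.
have := coverE x v; rewrite Ex E6 -scalerAr -scalerAl => /(scalerI c0).
by move/(canRL (divrK (spin_val_unit x))) => ->.
Qed.

Lemma turn_is_spin : spin_pred (turn e).
Proof.
apply/asboolP; exists [:: e 6; e 5]; split=> //.
  by move=> u; rewrite !inE => /orP[] /eqP ->; rewrite (frame_dot fe).
by rewrite big_cons big_seq1.
Qed.

Definition turn_spin : spin R 7 := Sub _ turn_is_spin.

Lemma turn_spinE : spin_val turn_spin = turn e.
Proof. by rewrite /spin_val SubK. Qed.

Lemma turnV : (turn e)^-1 = - turn e.
Proof.
have U : turn e \is a GRing.unit by rewrite -turn_spinE spin_val_unit.
by apply: (mulrI U); rewrite divrr // mulrN (turn_sqr fe) opprK.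
Qed.

Lemma turn_cover : spin_cover turn_spin *m v = - v.
Proof.
apply: iota_inj; rewrite -coverE turn_spinE turnV.
have [c _ vE] := frame_line fe; rewrite linearN /=.
have -> : iota_cl v = c *: E 6 by rewrite {1}vE linearZ.
rewrite -scalerAr -scalerAl  -scalerN; congr (_ *: _).
rewrite mulrN -(opprK (turn e * _)) -(turn6 fe) mulNr opprK.
by rewrite -mulrA (turn_sqr fe) mulrN1.
Qed.

Lemma turn_stab : stab_line v turn_spin.
Proof. by rewrite /stab_line turn_cover memvN memv_line. Qed.

Definition turnN : N v := Sub _ turn_stab.

Lemma turnN_val : spin_val turnN = turn e.
Proof. by rewrite -turn_spinE /N_val SubK. Qed.

Lemma turnN_N0 : ~~ N0 v turnN.
Proof.
apply/N0P; rewrite /N_val SubK turn_cover => /eqP.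
by rewrite eq_sym -addr_eq0 -mulr2n -scaler_nat scaler_eq0 pnatr_eq0 (negPf v0).
Qed.

Lemma turnN_J x : N0 v x ->
  spin_val (N_val (turnN * x * turnN^-1)%g) = cl_reflect e (spin_val x).
Proof.
move=> Nx; apply: (mulIr (spin_val_unit turnN)); rewrite -N_valM mulgKV N_valM turnN_val.
rewrite /turn -mulrA (reflectE fe) mulrA (ev_comm6 fe) -?mulrA //.
exact/(ev_reflect fe)/N0_ev.
Qed.

End WithFrame.

End N0.

(** * Complex conjugation on SU(4) as a conjugation in N *)

Section HalfSpin.
Variables (R : realType) (v : 'cV[R]_7) (sigma : half_spin v).
Hypothesis v0 : v != 0.
Local Notation C := R[i].
Local Notation ev := (even_clifford_perp v).
Implicit Types (x y : N v).

(** The half-spin representation, as a function on N; only its values on the identity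
    component are meaningful. *)
Definition spinor x : 'M[C]_4 := sigma (spin_val x).

Lemma spinor_inj x y : N0 v x -> N0 v y -> spinor x = spinor y -> x = y.
Proof.
move=> Nx Ny E; rewrite -(half_spinK sigma Nx) -(half_spinK sigma Ny).
by rewrite -/(spinor x) E.
Qed.

Lemma spinorM x y : N0 v x -> N0 v y -> spinor (x * y)%g = spinor x *m spinor y.
Proof.
have [e fe] := frame_exists v0 => Nx Ny; rewrite /spinor N_valM.
by apply: half_spinM; apply: (N0_ev v0 fe).
Qed.

Lemma spinor1 : spinor 1%g = 1%:M.
Proof. by rewrite /spinor -(half_spin1 sigma) (spin_val1 R 7). Qed.

Lemma spinorV x : N0 v x -> spinor x *m spinor (x^-1)%g = 1%:M.
Proof. by move=> Nx; rewrite -spinorM ?mulgV ?spinor1 //; apply: N0_V. Qed.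

Lemma spinorJ x y : N0 v x -> N0 v y ->
  spinor (y * x * y^-1)%g *m spinor y = spinor y *m spinor x.
Proof.
by move=> Nx Ny; rewrite -!spinorM ?mulgKV //; apply: N0_J.
Qed.

Lemma half_spin0 : sigma 0 = 0.
Proof.
have := half_spinP sigma (-1) (EvenOne v) (EvenOne v).
by rewrite scaleN1r addNr rmorphN1 scaleN1r addNr.
Qed.

Lemma half_spinN (x : clifford R 7) : ev x -> sigma (- x) = - sigma x.
Proof.
move=> ex; have := half_spinP sigma (-1) ex (evZ 0 ex).
by rewrite scale0r half_spin0 !addr0 rmorphN1 !scaleN1r.
Qed.

Lemma spinorN x : N0 v x -> spinor (neg1 v * x)%g = - spinor x.
Proof.
have [e fe] := frame_exists v0 => Nx; rewrite /spinor N_valM val_neg1 mulN1r.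
by rewrite half_spinN //; apply: (N0_ev v0 fe).
Qed.

Lemma spinor_surj A : SU4 A -> exists2 x, N0 v x & spinor x = A.
Proof.
by move=> SA; exists (su4_inv sigma A); [apply: su4_inv_N0 | apply: su4_invK].
Qed.

Section Frame.
Variables (e : nat -> 'cV[R]_7) (fe : frame v e).
Local Notation E j := (iota_cl (e j) : clifford R 7).

Definition half_spin_gen j : 'M[C]_3.+1 := sigma (E 5 * E j).

Lemma gen_clifford : clifford_gens 4 half_spin_gen.
Proof.
split=> [j j4|j k j4 k4 jk]; have j6 : (j <= 6)%N by apply: leq_trans j4 _.
  have j5 : (j < 6)%N by apply: leq_trans (_ : (5 <= 6)%N).
  rewrite /half_spin_gen -mulmxE -half_spinM; try exact: ev_gen.
  rewrite (gen_mul fe) // (frame_sqr fe) // half_spinN ?half_spin1 //.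
  exact: EvenOne.
have k6 : (k <= 6)%N by apply: leq_trans k4 _.
have j5 : (j < 6)%N by apply: leq_trans (_ : (5 <= 6)%N).
have k5 : (k < 6)%N by apply: leq_trans (_ : (5 <= 6)%N).
rewrite /half_spin_gen -!mulmxE -!half_spinM; try exact: ev_gen.
rewrite !(gen_mul fe) // (frame_anti fe) // half_spinN //.
by apply: EvenGen; apply: (frame_perp fe).
Qed.

(** The product of an odd number of generators commutes with all of them, hence is a
    scalar by Schur's lemma; its square is -1 whichever of the two half-spin
    representations was chosen. *)
Lemma gen_volume : exists2 c : C, c ^+ 2 = -1 & \prod_(0 <= j < 5) half_spin_gen j = c%:M.
Proof.
pose P : 'M[C]_4 := \prod_(0 <= j < 5) half_spin_gen j.
have evP x : ev x -> P *m sigma x = sigma x *m P.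
  move=> ex; suff [] : ev x /\ P *m sigma x = sigma x *m P by [].
  elim/(ev_ind fe): ex => [|a y z [ey Ey] [ez Ez]|y z [ey Ey] [ez Ez]|j j5].
  - by split; [exact: EvenOne | rewrite half_spin1 mulmx1 mul1mx].
  - split; first exact: EvenLin.
    by rewrite half_spinP // mulmxDr mulmxDl -scalemxAr -scalemxAl Ey Ez.
  - split; first exact: EvenMul.
    by rewrite half_spinM // mulmxA Ey -!mulmxA Ez.
  split; first by apply: (ev_gen fe); apply: ltnW.
  have := volume_comm gen_clifford (k := 5) (l := j); rewrite j5 => /(_ isT).
  by rewrite /= -signr_odd mul1r.
have [c Pc] : exists c, P = c%:M.
  apply: SU4_commutant => A SA; have [x Nx <-] := spinor_surj SA.
  exact/evP/(N0_ev v0 fe).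
exists c => //; have := volume_sqr gen_clifford (leqnn 5).
rewrite -/P Pc -signr_odd => /matrixP/(_ 0 0).
by rewrite -mulmxE -scalar_mxM !mxE.
Qed.

Lemma conj_clifford :
  clifford_gens 4 (fun j => - map_mx Num.conj (half_spin_gen j) : 'M[C]_3.+1).
Proof.
have [Bsq Banti] := gen_clifford.
split=> [j j4|j k j4 k4 jk].
  by rewrite mulrNN -mulmxE -map_mxM mulmxE Bsq // map_mxN map_mx1.
by rewrite !mulrNN -mulmxE -!map_mxM !mulmxE Banti // map_mxN.
Qed.

(** As c is i or -i, it is the opposite of its conjugate; the sign of an odd number of
    factors compensates this. *)
Lemma conj_volume (c : C) : c ^+ 2 = -1 -> \prod_(0 <= j < 5) half_spin_gen j = c%:M ->
  \prod_(0 <= j < 5) (- map_mx Num.conj (half_spin_gen j)) = c%:M.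
Proof.
move=> c2 Pc.
have PE k : \prod_(0 <= j < k) (- map_mx Num.conj (half_spin_gen j)) =
    (-1) ^+ k * map_mx Num.conj (\prod_(0 <= j < k) half_spin_gen j) :> 'M[C]_3.+1.
  elim: k => [|k IHk]; first by rewrite !big_geq // mul1r map_mx1.
  rewrite !big_nat_recr //= IHk exprS -[in RHS]mulmxE map_mxM mulmxE.
  by rewrite mulN1r mulrN mulNr mulrA.
have c0 : c != 0 by apply: contra_eq_neq c2 => ->; rewrite expr0n eq_sym oppr_eq0 oner_eq0.
have n1 : `|c| ^+ 2 = 1.
  by rewrite -normrX c2 normrN1.
have cc : c^* = - c.
  by apply: (mulfI c0); rewrite -normCK n1 mulrN -expr2 c2 opprK.
rewrite PE Pc -signr_odd expr1 mulN1r map_scalar_mx /= cc.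
by rewrite -scalemx1 -scaleNr scalemx1 opprK.
Qed.

Lemma conj_real (a : R) : Num.conj (a%:C%C : C) = a%:C%C.
Proof. exact: conjc_real. Qed.

(** Reflecting before applying sigma and conjugating after it give two morphisms of
    real algebras on the even Clifford algebra, so an intertwiner only has to be
    checked on the generators e_5 e_j. *)
Lemma charge_conjugation : exists2 X : 'M[C]_4, X != 0 &
  forall x, N0 v x ->
    X *m spinor (turnN fe * x * (turnN fe)^-1)%g = map_mx Num.conj (spinor x) *m X.
Proof.
have [c c2 Pc] := gen_volume.
have [X X0 XB] := clifford_intertwiner gen_clifford conj_clifford Pc (conj_volume c2 Pc).
exists X => // x Nx; rewrite /spinor turnN_J //.
have := N0_ev v0 fe Nx; move: (spin_val x) => {Nx} y ey.
suff [] : ev y /\ X *m sigma (cl_reflect e y) = map_mx Num.conj (sigma y) *m X by [].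
elim/(ev_ind fe): ey => {y} [|a y z [ey Ey] [ez Ez]|y z [ey Ey] [ez Ez]|j j5].
- by split; [exact: EvenOne | rewrite (reflect1 fe) half_spin1 map_mx1 mulmx1 mul1mx].
- split; first exact: EvenLin.
  rewrite reflect_lin !half_spinP //; try exact: (ev_reflect fe).
  rewrite mulmxDr -scalemxAr Ey Ez map_mxD map_mxZ mulmxDl -scalemxAl.
  by rewrite /= conj_real.
- split; first exact: EvenMul.
  rewrite (reflectM fe) !half_spinM //; try exact: (ev_reflect fe).
  by rewrite mulmxA Ey -mulmxA Ez map_mxM mulmxA.
split; first by apply: (ev_gen fe); apply: ltnW.
rewrite (reflect_gen fe) // half_spinN; last by apply: (ev_gen fe); apply: ltnW.
by have := XB j j5; rewrite -!mulmxE mulNmx mulmxN => ->; rewrite opprK.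
Qed.

End Frame.

(** The two half-spin representations are conjugate to each other, and the elements of
    N outside the identity component exchange them.  The intertwiner found above
    becomes an element of SU(4) after scaling, and is absorbed in J. *)
Lemma outer_conjugation : exists2 J : N v, ~~ N0 v J &
  forall x, N0 v x -> spinor (J * x * J^-1)%g = map_mx Num.conj (spinor x).
Proof.
have [e fe] := frame_exists v0; have [X X0 XE] := charge_conjugation fe.
pose T := turnN fe; have TN : ~~ N0 v T := turnN_N0 v0 fe.
have [c SX] : exists c, SU4 (c *: X).
  apply: SU4_normalize => // A SA.
  have [y Ny yA] := spinor_surj SA.
  pose x := (T^-1 * y * T)%g; have Nx : N0 v x by rewrite /x -{2}[T]invgK; apply: N0_J.
  have Ey : y = (T * x * T^-1)%g by rewrite /x !mulgA mulgV mul1g mulgK.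
  have E := XE x Nx; rewrite -/T -Ey yA in E.
  have /unitarymxP U : A \is unitarymx by case: SA.
  have /unitarymxP/mulmx1C/(congr1 trmx) : spinor x \is unitarymx.
    by case: (half_spin_SU4 sigma Nx).
  rewrite trmx_mul trmx1 => W.
  (* X A = conj(sigma(x)) X with unitary A and sigma(x). *)
  have EE : (X *m A) ^t* *m (X *m A) = X ^t* *m X.
    have tE : (map_mx Num.conj (spinor x) *m X) ^t* = X ^t* *m (spinor x)^T.
      rewrite trmx_mul map_mxM; congr (_ *m _).
      by apply/matrixP=> i j; rewrite !mxE /= conjCK.
    rewrite {1}E tE E -!mulmxA; congr (_ *m _); rewrite mulmxA.
    rewrite (_ : map_mx Num.conj (spinor x) = (spinor x ^t*)^T) ?W ?mul1mx //.
    by apply/matrixP=> i j; rewrite !mxE.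
  rewrite -{2}EE trmx_mul map_mxM !mulmxA U mul1mx.
  by rewrite -!mulmxA.
have [y Ny yX] := spinor_surj SX.
exists (y * T)%g.
  apply: contra TN => Ny'; rewrite -[T](mulKg y); apply: N0_M => //.
  exact: N0_V.
move=> x Nx; pose z := (T * x * T^-1)%g.
have Nz : N0 v z by apply: N0_J.
have -> : (y * T * x * (y * T)^-1 = y * z * y^-1)%g.
  by rewrite /z invMg !mulgA.
have := spinorJ Nz Ny; rewrite yX -scalemxAl (XE x Nx) scalemxAr.
move/(congr1 (mulmx^~ (spinor y^-1%g))); rewrite -!mulmxA -yX spinorV // !mulmx1.
by [].
Qed.

End HalfSpin.

(** * Orthogonal similitudes of the plane *)

Section Mx2.
Variable F : comNzRingType.
Implicit Types A B : 'M[F]_2.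

Lemma mx2P A B : A 0 0 = B 0 0 -> A 0 1 = B 0 1 -> A 1 0 = B 1 0 -> A 1 1 = B 1 1 -> A = B.
Proof.
move=> E1 E2 E3 E4; apply/matrixP=> i j.
have I2 (k : 'I_2) : k = 0 \/ k = 1.
  by case: k => [[|[|]]] // ?; [left | right]; apply: val_inj.
by case: (I2 i) => ->; case: (I2 j) => ->.
Qed.

Lemma mulmx2E n (A : 'M[F]_(n, 2)) m (B : 'M[F]_(2, m)) i j :
  (A *m B) i j = A i 0 * B 0 j + A i 1 * B 1 j.
Proof.
rewrite !mxE !big_ord_recl big_ord0 addr0; congr (_ + A i _ * B _ j); exact: val_inj.
Qed.

Lemma det_mx2 A : \det A = A 0 0 * A 1 1 - A 0 1 * A 1 0.
Proof.
rewrite (expand_det_row _ 0) !big_ord_recl big_ord0 /cofactor !det_mx11 !mxE.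
rewrite /= addr0 expr0 expr1 mul1r mulN1r mulrN.
by congr (_ * A _ _ - A _ _ * A _ _); apply: val_inj.
Qed.

Lemma mxtrace2 A : \tr A = A 0 0 + A 1 1.
Proof.
by rewrite /mxtrace !big_ord_recl big_ord0 addr0; congr (_ + A _ _); apply: val_inj.
Qed.

Definition rot90 : 'M[F]_2 := \matrix_(i, j) if i == j then 0 else if i == 0 then -1 else 1.

Lemma rotE : (rot90 0 0 = 0) * (rot90 0 1 = -1) * (rot90 1 0 = 1) * (rot90 1 1 = 0).
Proof. by rewrite !mxE. Qed.

Lemma rot_sqr : rot90 *m rot90 = - 1%:M.
Proof.
by apply: mx2P; rewrite mulmx2E !rotE !mxE /= ?mulr0n ?mulr1n; ring.
Qed.

Lemma det_rot : \det rot90 = 1.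
Proof. by rewrite det_mx2 !rotE; ring. Qed.

(** rot90 g^T rot90^-1 is the adjugate of g. *)
Lemma rot_congruence A : A *m rot90 *m A^T = \det A *: rot90.
Proof.
apply: mx2P; rewrite !(mulmx2E, mxE) det_mx2 /=; ring.
Qed.

End Mx2.
Arguments rot90 {F}.

Section O2.
Variable R : realType.
Local Notation C := R[i].
Implicit Types (g h : O2pm R).

Lemma O2pmP g : [/\ GO2C g, O2pm_mx g \is unitarymx & simf g = 1 \/ simf g = -1].
Proof. by case/asboolP: (valP g) => [[? ?] ?]. Qed.

Lemma simf_sqr g : simf g * simf g = 1.
Proof. by have [_ _ [] ->] := O2pmP g; rewrite ?mulrNN mulr1. Qed.

(** Polarisation of the similitude relation. *)
Lemma simf_gram g : (O2pm_mx g)^T *m g = (simf g)%:M.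
Proof.
have [[_ Hg] _ _] := O2pmP g.
have H0 := Hg (delta_mx 0 0); have H1 := Hg (delta_mx 1 0).
have H2 := Hg (delta_mx 0 0 + delta_mx 1 0).
move: H0 H1 H2; rewrite /qform mulmxDr -!colE !mxE /=.
rewrite !expr0n !expr1n /= !(add0r, addr0, mulr1) expr1n => H0 H1 H2.
have ab : g 0 0 * g 0 1 + g 1 0 * g 1 1 = 0.
  have : (g 0 0 * g 0 1 + g 1 0 * g 1 1) *+ 2 = 0.
    transitivity (((g 0 0 + g 0 1) ^+ 2 + (g 1 0 + g 1 1) ^+ 2)
       - (g 0 0 ^+ 2 + g 1 0 ^+ 2) - (g 0 1 ^+ 2 + g 1 1 ^+ 2)); first by ring.
    by rewrite H0 H1 H2; ring.
  by move/eqP; rewrite mulrn_eq0 /= => /eqP.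
apply: mx2P; rewrite mulmx2E !mxE /= ?mulr0n ?mulr1n -?expr2 //.
by rewrite ![_ 0 1 * _]mulrC [g 1 1 * _]mulrC.
Qed.

(** The transpose of g is mu(g) g^-1 because g is a similitude of the bilinear form, and
    its conjugate transpose is g^-1 because g is unitary. *)
Lemma conj_O2 g : map_mx Num.conj (O2pm_mx g) = simf g *: O2pm_mx g.
Proof.
have [_ /unitarymxP/mulmx1C U _] := O2pmP g.
have E : (O2pm_mx g) ^t* = simf g *: (O2pm_mx g)^T.
  have : (O2pm_mx g)^T *m g *m (g : 'M_2) ^t* = simf g *: ((g : 'M_2) ^t*).
    by rewrite simf_gram mul_scalar_mx.
  rewrite -mulmxA (mulmx1C U) mulmx1 => E1.
  by rewrite [in RHS]E1 scalerA simf_sqr scale1r.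
by apply/matrixP=> i j; have /matrixP/(_ j i) := E; rewrite !mxE.
Qed.

Lemma rot_O2 g : (O2pm_mx g) *m rot90 = (simf g * \det g) *: (rot90 *m g).
Proof.
have /(congr1 (mulmx^~ (O2pm_mx g))) := rot_congruence (O2pm_mx g).
rewrite /= -(mulmxA (O2pm_mx g *m rot90)).
rewrite simf_gram mul_mx_scalar -scalemxAl.
move/(congr1 (fun A => simf g *: A)).
by rewrite /= !scalerA simf_sqr scale1r.
Qed.

(** The isotropic lines are the eigenlines of rot90, for the eigenvalues i and -i; g
    keeps or exchanges them according to whether it commutes or anticommutes with
    rot90. *)
Lemma epsilon_det g : epsilon g = simf g * \det g.
Proof.
have [G _ mu] := O2pmP g.
have [s sE] : exists s : bool, simf g * \det g = (-1) ^+ s.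
  have : (simf g * \det g) ^+ 2 = 1.
    by rewrite exprMn !expr2 simf_sqr det_O2pm mulr1.
  move/eqP; rewrite sqrf_eq1 => /orP[] /eqP ->; first by exists false.
  by exists true.
pose t : 'S_2 := if s then tperm 0 1 else 1%g.
have ot : odd_perm t = s by rewrite /t; case: s {sE t}; rewrite ?odd_tperm ?odd_perm1.
rewrite /epsilon (@permutes_lines_uniq _ _ _ t G.1 (line_permP G)) ?ot //.
apply/forallP=> j; rewrite iso_lineP.
have := congr1 (mulmx^~ (iso_vec R j)) (rot_O2 g).
rewrite /= -!mulmxA -scalemxAl -mulmxA sE => /matrixP/(_ 0 0).
have -> : rot90 *m iso_vec R j = (- ((-1) ^+ j * 'i%C)) *: iso_vec R j.
  have yy : ((-1) ^+ j * 'i%C) * ((-1) ^+ j * 'i%C) = -1 :> C.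
    by rewrite mulrACA Defs.sqr_i -expr2 sqrr_sign mul1r.
  apply/matrixP=> k l; rewrite ord1 mulmx2E; case: (unliftP 0 k) => [k' ->|->].
    rewrite ord1 (_ : lift 0 0 = 1) ?rotE; last exact: val_inj.
    by rewrite !mxE /= mulNr yy; ring.
  by rewrite rotE !mxE /=; ring.
set w := _ *m iso_vec R j; rewrite -scalemxAr -/w; move: w => w.
rewrite !mxE [X in _ = _ * X](_ : _ = - w 1 0).
  move=> E; have -> : (-1) ^+ (t j) = (-1) ^+ s * (-1) ^+ j :> C.
    rewrite /t; case: (s); last by rewrite perm1 mul1r.
    have I2 (k : 'I_2) : k = 0 \/ k = 1.
      by case: k => [[|[|]]] // ?; [left | right]; apply: val_inj.
    by case: (I2 j) => ->; rewrite ?tpermL ?tpermR expr1 ?mulrNN ?mulr1.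
  apply/eqP; have {}E : (-1) ^+ s * w 1 0 = (-1) ^+ j * 'i%C * w 0 0.
    by apply: oppr_inj; rewrite -mulrN -E mulNr.
  by rewrite -!mulrA [_ * (_ * w 0 0)]mulrA -E mulrA -expr2 sqrr_sign mul1r.
by rewrite !big_ord_recl big_ord0 /= !mxE /= mul0r add0r addr0 mulN1r;
  congr (- w _ _); apply: val_inj.
Qed.

Lemma epsilon_sqr g : epsilon g * epsilon g = 1.
Proof. by rewrite /epsilon -expr2 sqrr_sign. Qed.

Lemma epsilonP g : epsilon g = 1 \/ epsilon g = -1.
Proof. by rewrite /epsilon; case: (odd_perm _); [right | left]. Qed.

Lemma rot_comm g : O2pm_mx g *m rot90 = epsilon g *: (rot90 *m g).
Proof. by rewrite epsilon_det rot_O2. Qed.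

Lemma det_epsilon g : \det g = simf g * epsilon g.
Proof. by rewrite epsilon_det mulrA simf_sqr mul1r. Qed.

Lemma O2_entries g : g 0 1 = - epsilon g * g 1 0 /\ g 0 0 = epsilon g * g 1 1.
Proof.
have E i j : (O2pm_mx g *m rot90) i j = epsilon g * (rot90 *m O2pm_mx g) i j.
  by rewrite rot_comm [LHS]mxE.
have := E 0 0; have := E 0 1.
rewrite !mulmx2E !rotE !(mulr0, mul0r, addr0, add0r, mulr1, mul1r) !mulrN1 !mulN1r.
by rewrite mulrN => /oppr_inj E1 ->; rewrite mulrN mulNr.
Qed.

Lemma trace_reflection g : epsilon g = -1 -> \tr g = 0.
Proof. by move=> eg; have [_ E] := O2_entries g; rewrite mxtrace2 E eg mulN1r addNr. Qed.

Lemma rotation_entries g : epsilon g = 1 -> O2pm_mx g = (g 1 1)%:M + g 1 0 *: rot90.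
Proof.
move=> eg; have [E1 E2] := O2_entries g; move: E1 E2; rewrite eg mulN1r mul1r => E1 E2.
by apply: mx2P; rewrite !mxE /= ?mulr0n ?mulr1n ?mulr0 ?mulr1 ?mulrN1 ?addr0 ?add0r.
Qed.

Lemma rotation_norm g : epsilon g = 1 -> g 1 1 ^+ 2 + g 1 0 ^+ 2 = simf g.
Proof.
move=> eg; have /matrixP/(_ 1 1) := simf_gram g.
have [E1 E2] := O2_entries g; rewrite mulmx2E !mxE E1 eg /= mulr1n => <-.
ring.
Qed.

Lemma quarter_turn g : epsilon g = 1 -> simf g = -1 -> \tr g = 0 ->
  exists s : bool, O2pm_mx g = ((-1) ^+ s * 'i%C) *: rot90.
Proof.
move=> eg mg tg; have := rotation_norm eg; rewrite mg.
have g11 : g 1 1 = 0.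
  have [_ E] := O2_entries g; move: tg; rewrite mxtrace2 E eg mul1r -mulr2n => /eqP.
  by rewrite mulrn_eq0 => /eqP.
have gE := rotation_entries eg; rewrite g11 raddf0 add0r in gE.
rewrite g11 expr0n add0r => N; have : g 1 0 ^+ 2 = 'i%C ^+ 2.
  by rewrite N expr2 Defs.sqr_i.
move/eqP; rewrite eqf_sqr => /orP[] /eqP g10; rewrite gE g10.
  by exists false; rewrite mul1r.
by exists true; rewrite expr1 mulN1r.
Qed.

Lemma reflection_sqr g : epsilon g = -1 -> O2pm_mx (g ^+ 2)%g = (simf g)%:M.
Proof.
move=> eg; have /matrixP/(_ 1 1) := simf_gram g.
have [E1 E2] := O2_entries g; move: E1 E2; rewrite eg mulN1r opprK mul1r => E1 E2.
rewrite mulmx2E !mxE /= mulr1n => <-; rewrite (expgS _ 1) expg1 O2pm_mxM.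
by apply: mx2P; rewrite mulmx2E ?mxE /= ?mulr0n ?mulr1n ?E1 ?E2; ring.
Qed.

Lemma O2pm_inj g h : O2pm_mx g = O2pm_mx h -> g = h.
Proof. exact: val_inj. Qed.

Lemma simf_mul g h : simf (O2pm_mx (g * h)%g) = simf g * simf h.
Proof. by rewrite O2pm_mxM simfM //; apply: O2pm_GO2C. Qed.

Lemma epsilon_mul g h : epsilon (O2pm_mx (g * h)%g) = epsilon g * epsilon h.
Proof. by rewrite O2pm_mxM epsilonM //; apply: O2pm_GO2C. Qed.

Lemma simf_one : simf (O2pm_mx (1%g : O2pm R)) = 1.
Proof. by rewrite O2pm_mx1 simf1. Qed.

Lemma epsilon_one : epsilon (O2pm_mx (1%g : O2pm R)) = 1.
Proof. by rewrite epsilon_det simf_one O2pm_mx1 det1 mulr1. Qed.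

Lemma involution_inv (F : comNzRingType) (x y : F) : x * x = 1 -> x * y = 1 -> y = x.
Proof. by move=> xx xy; rewrite -[y]mul1r -xx -mulrA xy mulr1. Qed.

Lemma simf_inv g : simf (O2pm_mx (g^-1)%g) = simf g.
Proof.
by apply: involution_inv (simf_sqr g) _; rewrite -simf_mul mulgV simf_one.
Qed.

Lemma epsilon_inv g : epsilon (O2pm_mx (g^-1)%g) = epsilon g.
Proof.
by apply: involution_inv (epsilon_sqr g) _; rewrite -epsilon_mul mulgV epsilon_one.
Qed.

Lemma O2pm_unit g : O2pm_mx g \in unitmx.
Proof. by have [[]] := O2pmP g. Qed.

End O2.

(** * Dihedral images in the plane group *)

Section ScalarCommutation.
Variable R : realType.
Implicit Types (p g h : O2pm R) (k l : R[i]).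

(** Conjugation by p multiplies g by the scalar k; stated without inverses. *)
Definition commutes_up_to k p g : Prop := O2pm_mx p *m g = k *: (O2pm_mx g *m p).

Lemma commutes_up_toM k l p g h : commutes_up_to k p g -> commutes_up_to l p h ->
  commutes_up_to (k * l) p (g * h)%g.
Proof.
rewrite /commutes_up_to O2pm_mxM => Eg Eh.
by rewrite mulmxA Eg -scalemxAl -mulmxA Eh -scalemxAr scalerA mulmxA.
Qed.

Lemma commutes_up_toX k p g n : commutes_up_to k p g ->
  commutes_up_to (k ^+ n) p (g ^+ n)%g.
Proof.
move=> pg; elim: n => [|n IHn].
  by rewrite /commutes_up_to O2pm_mx1 mulmx1 mul1mx scale1r.
by rewrite exprS expgS; apply: commutes_up_toM.
Qed.

Lemma simfX g n : simf (O2pm_mx (g ^+ n)%g) = simf g ^+ n.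
Proof. by elim: n => [|n IHn]; rewrite ?simf_one // expgS simf_mul IHn exprS. Qed.

Lemma epsilonX g n : epsilon (O2pm_mx (g ^+ n)%g) = epsilon g ^+ n.
Proof. by elim: n => [|n IHn]; rewrite ?epsilon_one // expgS epsilon_mul IHn exprS. Qed.

End ScalarCommutation.

Section Images.
Variables (R : realType) (Gam : groupType) (f : {multiplicative Gam -> O2pm R}).
Implicit Types x y : Gam.
Local Notation fm x := (O2pm_mx (f x)).
Variables (b a : Gam).
Hypotheses (eb : epsilon (fm b) = 1) (mb : simf (fm b) = -1).
Hypotheses (ea : epsilon (fm a) = -1) (ma : simf (fm a) = 1).

(** The elements with epsilon = 1 and mu = -1 are i times rotations; trace 0 says that
    the rotation is a quarter turn. *)
Definition quarter_turns :=
  forall x, epsilon (fm x) = 1 -> simf (fm x) = -1 -> \tr (fm x) = 0.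

(** Let s = u + w rot90 be an image with epsilon = 1 and mu = -1, and a one with
    epsilon = -1.  Then a^-1 s a = u - w rot90 commutes with s, and the
    commutator of s and a squares to 1, so (u + w rot90)^2 = (u - w rot90)^2 and
    u w = 0.  If u is not 0
    then s = u is central, so its square is 1, while u^2 = mu(s) = -1. *)
Lemma dihedral_quarter_turns : image_isog f ('D_8)%type -> quarter_turns.
Proof.
move=> iso x ex mx; apply/eqP; apply: contraT => tx.
have [c2 cen] := image_isog_central iso dihedral8_central x a.
have E := rotation_entries ex; set u := fm x 1 1 in E; set w := fm x 1 0 in E.
have u0 : u != 0.
  have [_ E2] := O2_entries (f x); apply: contraNneq tx => u0.
  by rewrite mxtrace2 E2 -/u u0 mulr0 addr0.
have [s' s'def] : exists s', s' = (f x ^ f a)%g by eexists.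
have s'E : O2pm_mx s' = u%:M - w *: rot90.
  have : O2pm_mx (f a * s')%g = O2pm_mx (f x * f a)%g.
    by rewrite s'def conjgE !mulgA mulgV mul1g.
  rewrite !O2pm_mxM E mulmxDl -scalemxAl.
  have -> : rot90 *m fm a = - (fm a *m rot90) by rewrite rot_comm ea scaleN1r opprK.
  rewrite -scalar_mxC scalerN scalemxAr -mulmxN -mulmxDr.
  move/(congr1 (mulmx (invmx (fm a)))).
  by rewrite !mulKmx // O2pm_unit.
have com : commute (f x) s'.
  apply: O2pm_inj; rewrite !O2pm_mxM s'E E.
  by apply: mx2P; rewrite !mulmx2E !mxE /= ?mulr0n ?mulr1n; ring.
have ss : (s' ^+ 2 = f x ^+ 2)%g.
  have -> : s' = (f x * [~ f x, f a])%g by rewrite s'def commgEl mulKVg.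
  rewrite expgMn ?c2 ?mulg1 //.
  by rewrite commgEl -s'def; apply: commuteM com; apply/commuteV.
have uw : u * w = 0.
  have := congr1 (fun g : O2pm R => O2pm_mx g) ss.
  rewrite !(expgS _ 1) !expg1 !O2pm_mxM s'E E => /matrixP/(_ 1 0).
  rewrite !mulmx2E !mxE /= ?mulr0n ?mulr1n => E4.
  have : (u * w) *+ 4 = 0.
    by move/eqP: E4; rewrite -subr_eq0 => /eqP E4; rewrite -oppr0 -E4; ring.
  by move/eqP; rewrite mulrn_eq0 => /eqP.
have w0 : w = 0 by move/eqP: uw; rewrite mulf_eq0 (negPf u0) => /eqP.
have Eu : O2pm_mx (f x) = u%:M by rewrite E w0 scale0r addr0.
have x2 : (f x ^+ 2 = 1)%g.
  apply: cen => z; apply: O2pm_inj.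
  by rewrite !O2pm_mxM Eu scalar_mxC.
have := rotation_norm ex; rewrite mx -/u -/w w0 expr0n addr0.
have := congr1 (fun g : O2pm R => O2pm_mx g 0 0) x2.
rewrite !(expgS _ 1) !expg1 O2pm_mxM Eu O2pm_mx1 -scalar_mxM !mxE /= !mulr1n => <-.
rewrite expr2 => /eqP; rewrite -addr_eq0 -mulr2n mulrn_eq0 /= mulf_eq0 (negPf u0).
by [].
Qed.

Section Quarter.
Hypothesis qf : quarter_turns.

Lemma quarter_sqr : (f b ^+ 2 = 1)%g.
Proof.
have [s E] := quarter_turn eb mb (qf eb mb).
apply: O2pm_inj; rewrite (expgS _ 1) expg1 O2pm_mxM E O2pm_mx1.
rewrite -scalemxAl -scalemxAr scalerA rot_sqr mulrACA Defs.sqr_i -expr2.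
by rewrite sqrr_sign mul1r scaleN1r opprK.
Qed.

Lemma refl_sqr : (f a ^+ 2 = 1)%g.
Proof. by apply: O2pm_inj; rewrite reflection_sqr // ma O2pm_mx1. Qed.

Lemma quarter_prod_sqr : O2pm_mx ((f a * f b) ^+ 2)%g = (-1)%:M.
Proof.
rewrite reflection_sqr ?epsilon_mul ?ea ?eb ?mulr1 //.
by rewrite simf_mul ma mb mul1r.
Qed.

(** Both x b and b map to i rot90 or - i rot90, so x maps to
    1 or -1, and -1 is the square of the image of a b. *)
Lemma quarter_kernel x : epsilon (fm x) = 1 -> simf (fm x) = 1 ->
  exists i, f x = ((f a * f b) ^+ (i.*2))%g.
Proof.
move=> ex mx.
have exb : epsilon (fm (x * b)%g) = 1 by rewrite gmulfM epsilon_mul ex eb mulr1.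
have mxb : simf (fm (x * b)%g) = -1 by rewrite gmulfM simf_mul mx mb mul1r.
have [s E] := quarter_turn eb mb (qf eb mb).
have [t E'] := quarter_turn exb mxb (qf exb mxb).
have xE : O2pm_mx (f x) = ((-1) ^+ (s (+) t)) *: 1%:M.
  have xb : O2pm_mx (f x) *m fm b = ((-1) ^+ (s (+) t)) *: fm b.
    rewrite -O2pm_mxM -gmulfM E' E scalerA signr_addb.
    by rewrite mulrAC mulrA -expr2 sqrr_sign mul1r mulrC.
  by rewrite -[LHS](mulmxK (O2pm_unit (f b))) xb -scalemxAl mulmxV ?O2pm_unit.
exists (s (+) t : nat); apply: O2pm_inj; rewrite xE.
case: (s (+) t); last by rewrite scale1r O2pm_mx1.
by rewrite [true.*2]/= quarter_prod_sqr scalemx1.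
Qed.

(** The elements 1, a b a, a and a b realise the four values of (epsilon, mu), which
    reduces the claim to the kernel. *)
Lemma quarter_words x : exists i j, f x = ((f a * f b) ^+ i * f a ^+ j)%g.
Proof.
have words w i j : f w = ((f a * f b) ^+ i * f a ^+ j)%g ->
    epsilon (fm x) = epsilon (fm w) -> simf (fm x) = simf (fm w) ->
    exists i j, f x = ((f a * f b) ^+ i * f a ^+ j)%g.
  move=> fw ew mw; have [||k E] := @quarter_kernel (x * w^-1)%g.
  - by rewrite gmulfM mul_morphV epsilon_mul epsilon_inv ew epsilon_sqr.
  - by rewrite gmulfM mul_morphV simf_mul simf_inv mw simf_sqr.
  exists (k.*2 + i)%N, j; rewrite expgnDr -mulgA -fw -E gmulfM mul_morphV.
  by rewrite mulgKV.
have [ex|ex] := epsilonP (f x); have [_ _ [mx|mx]] := O2pmP (f x).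
- apply: (words 1%g 0%N 0%N); first by rewrite mul_morph1 mulg1.
    by rewrite mul_morph1 epsilon_one.
  by rewrite mul_morph1 simf_one.
- apply: (words (a * b * a)%g 1%N 1%N); first by rewrite !expg1 !gmulfM.
    by rewrite !gmulfM !epsilon_mul ea eb ex mulr1 mulrNN mulr1.
  by rewrite !gmulfM !simf_mul ma mb mx mul1r mulr1.
- apply: (words a 0%N 1%N); first by rewrite mul1g expg1.
    by rewrite ex ea.
  by rewrite mx ma.
apply: (words (a * b)%g 1%N 0%N); first by rewrite expg1 mulg1 gmulfM.
  by rewrite gmulfM epsilon_mul ea eb ex mulr1.
by rewrite gmulfM simf_mul ma mb mx mul1r.
Qed.

Lemma quarter_turns_dihedral : image_isog f ('D_8)%type.
Proof.
apply: (image_dihedral8 (a := a) (b := b));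
  [exact: refl_sqr | exact: quarter_sqr | | | exact: quarter_words].
  apply/eqP=> /(congr1 (fun g : O2pm R => O2pm_mx g 0 0)).
  rewrite quarter_prod_sqr O2pm_mx1 !mxE /= !mulr1n => /eqP.
  by rewrite eq_sym -addr_eq0 -mulr2n mulrn_eq0 oner_eq0.
apply: O2pm_inj; rewrite (expgnA _ 2 2) (expgS _ 1) expg1 O2pm_mxM quarter_prod_sqr.
by rewrite -scalar_mxM mulrNN mulr1 O2pm_mx1.
Qed.

Lemma refl_anti : commutes_up_to (-1) (f a) (f b).
Proof.
have [s E] := quarter_turn eb mb (qf eb mb).
rewrite /commutes_up_to E -scalemxAr rot_comm ea -scalemxAl !scaleN1r.
by rewrite scalerN.
Qed.

Lemma refl_prod : commutes_up_to (-1) (f a) (f a * f b)%g.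
Proof.
by rewrite -[-1]mul1r; apply: commutes_up_toM refl_anti; rewrite /commutes_up_to scale1r.
Qed.

Lemma prod_refl : commutes_up_to (-1) (f a * f b)%g (f a).
Proof. by rewrite /commutes_up_to refl_prod scalerA mulrNN mulr1 scale1r. Qed.

(** The image of a commutes with itself and anticommutes with that of a b; mu has the
    matching values 1 and -1. *)
Lemma simf_conjugator x : commutes_up_to (simf (fm x)) (f a) (f x).
Proof.
have [i [j ->]] := quarter_words x.
have -> : simf (O2pm_mx ((f a * f b) ^+ i * f a ^+ j)%g) = (-1) ^+ i * 1 ^+ j.
  by rewrite simf_mul !simfX simf_mul ma mb mul1r.
apply: commutes_up_toM; apply: commutes_up_toX; first exact: refl_prod.
by rewrite /commutes_up_to scale1r.
Qed.

(** The image of a b commutes with itself and anticommutes with that of a; det has the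
    matching values 1 and -1. *)
Lemma det_conjugator x : commutes_up_to (\det (fm x)) (f a * f b)%g (f x).
Proof.
have [i [j ->]] := quarter_words x.
have -> : \det (O2pm_mx ((f a * f b) ^+ i * f a ^+ j)%g) = 1 ^+ i * (-1) ^+ j.
  rewrite det_epsilon simf_mul epsilon_mul !simfX !epsilonX simf_mul epsilon_mul.
  by rewrite ma mb ea eb mulr1 mul1r !expr1n mulr1 mulrA -expr2 sqrr_sign !mul1r.
apply: commutes_up_toM; apply: commutes_up_toX; last exact: prod_refl.
by rewrite /commutes_up_to scale1r.
Qed.

End Quarter.

End Images.

(** * Conjugacy of the two morphisms *)

Section BlockDiagonal.
Variable R : realType.
Local Notation C := R[i].
Implicit Types (A B : 'M[C]_2) (g : calG R).

Definition bdiag A B : 'M[C]_4 := block_mx A 0 0 B : 'M_(2 + 2).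

Lemma bdiagM A B A' B' : bdiag A B *m bdiag A' B' = bdiag (A *m A') (B *m B').
Proof.
rewrite /bdiag (@mulmx_block _ 2 2 2 2 2 2).
by rewrite !(mulmx0, mul0mx, addr0, add0r).
Qed.

Lemma bdiagZ k A B : k *: bdiag A B = bdiag (k *: A) (k *: B).
Proof. by rewrite /bdiag (@scale_block_mx _ 2 2 2 2) !scaler0. Qed.

Lemma bdiag_tr A B : \tr (bdiag A B) = \tr A + \tr B.
Proof. exact: (@mxtrace_block _ 2 2). Qed.

Lemma bdiag_conj A B :
  map_mx Num.conj (bdiag A B) = bdiag (map_mx Num.conj A) (map_mx Num.conj B).
Proof. by rewrite /bdiag (@map_block_mx _ _ _ 2 2 2 2) !map_mx0. Qed.

Lemma SU4_bdiag A B : A \is unitarymx -> B \is unitarymx -> \det A * \det B = 1 ->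
  SU4 (bdiag A B).
Proof.
move=> /unitarymxP UA /unitarymxP UB dAB; split; last by rewrite /bdiag (@det_ublock _ 2 2).
apply/unitarymxP; rewrite {2}/bdiag (@tr_block_mx _ 2 2 2 2) (@map_block_mx _ _ _ 2 2 2 2).
rewrite !trmx0 !map_mx0 -/(bdiag _ _) bdiagM UA UB.
by rewrite /bdiag -scalar_mx_block.
Qed.

Lemma rot_unitary : (rot90 : 'M[C]_2) \is unitarymx.
Proof.
apply/unitarymxP; apply: mx2P; rewrite mulmx2E !mxE /= ?(rmorph0, rmorphN, rmorph1);
  rewrite ?mulr0n ?mulr1n; ring.
Qed.

Lemma unitary_i A : A \is unitarymx -> 'i%C *: A \is unitarymx.
Proof.
move=> /unitarymxP U; apply/unitarymxP.
rewrite [('i%C *: A)^T]linearZ /= map_mxZ -scalemxAl -scalemxAr U scalerA /=.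
by rewrite -normCK -normrX expr2 Defs.sqr_i normrN1 scale1r.
Qed.

Lemma calG_det g : \det (calG_snd g) = dchar g.
Proof. by have /andP[/eqP E _] := valP g; exact: esym E. Qed.

Lemma calG_simf2 g : simf (calG_snd g) = upsilon g.
Proof. by have /andP[_ /eqP E] := valP g; exact: E. Qed.

Lemma calG_simf1 g : simf (calG_fst g) = upsilon g * dchar g.
Proof. by rewrite /upsilon epsilon_det -mulrA det_O2pm mulr1. Qed.

Lemma calG_epsilon2 g : epsilon (calG_snd g) = upsilon g * dchar g.
Proof. by rewrite epsilon_det calG_simf2 calG_det. Qed.

End BlockDiagonal.

Section Conjugation.
Variables (R : realType) (v : 'cV[R]_7) (sigma : half_spin v).
Hypothesis v0 : v != 0.
Implicit Types (x y z : N v) (g : calG R) (P : 'M[R[i]]_4).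
Local Notation spinor := (spinor sigma).

Lemma rho_N0 g : N0 v (rho sigma g).
Proof. exact/su4_inv_N0/rho_mx_SU4. Qed.

Lemma spinor_rho g : spinor (rho sigma g) = rho_mx g.
Proof. exact/su4_invK/rho_mx_SU4. Qed.

Lemma inner_conjP x y z : N0 v x -> N0 v y -> N0 v z ->
  spinor y *m spinor x = spinor z *m spinor y -> z = (y * x * y^-1)%g.
Proof.
move=> Nx Ny Nz E; apply/eqP; rewrite -(inj_eq (mulIg y)) mulgKV; apply/eqP.
by apply: (spinor_inj (sigma := sigma)); rewrite ?spinorM //; apply: N0_M.
Qed.

Lemma inner_trace x y : N0 v y -> N0 v x ->
  \tr (spinor (y * x * y^-1)%g) = \tr (spinor x).
Proof.
move=> Ny Nx; have := spinorJ sigma v0 Nx Ny.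
move/(congr1 (mulmx^~ (spinor y^-1%g))); rewrite /= -!mulmxA spinorV // mulmx1 => ->.
by rewrite mxtrace_mulC -mulmxA (mulmx1C (spinorV sigma v0 Ny)) mulmx1.
Qed.

Section Outer.
Variable J : N v.
Hypotheses (JN : ~~ N0 v J)
  (JE : forall x, N0 v x -> spinor (J * x * J^-1)%g = map_mx Num.conj (spinor x)).

(** An element outside the identity component is the product of one inside by J. *)
Lemma outer_trace x y : ~~ N0 v y -> N0 v x ->
  \tr (spinor (y * x * y^-1)%g) = \tr (map_mx Num.conj (spinor x)).
Proof.
move=> Ny Nx; have Nw : N0 v (y * J^-1)%g by apply: N0_MN => //; apply: N0_VN.
have Nz : N0 v (J * x * J^-1)%g by apply: N0_J.
rewrite -JE // -(inner_trace Nw Nz); congr (\tr (spinor _)).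
by rewrite invMg invgK !mulgA !mulgKV.
Qed.

Variable (Gam : groupType) (f : {multiplicative Gam -> calG R}).
Let eta (x : Gam) := upsilon (f x).
Let r (x : Gam) := rho sigma (f x).

Lemma upsilonP g : upsilon g = 1 \/ upsilon g = -1.
Proof. exact: epsilonP. Qed.

Lemma twist_N0 (x : Gam) : N0 v (twist eta r x).
Proof.
by rewrite /twist; case: ifP => _; rewrite ?N0_M ?N0_neg1 //; apply: rho_N0.
Qed.

Lemma spinor_twist (x : Gam) : spinor (twist eta r x) = eta x *: rho_mx (f x).
Proof.
rewrite /twist; case: eqP => [->|].
  by rewrite spinorN ?spinor_rho ?scaleN1r //; apply: rho_N0.
by have [] := upsilonP (f x); rewrite /eta => -> // _; rewrite scale1r spinor_rho.
Qed.

Lemma inner_twist P (x : Gam) : SU4 P -> P *m rho_mx (f x) = eta x *: (rho_mx (f x) *m P) ->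
  twist eta r x = (su4_inv sigma P * r x * (su4_inv sigma P)^-1)%g.
Proof.
move=> SP E; apply: inner_conjP; rewrite ?twist_N0 ?rho_N0 ?su4_inv_N0 //.
by rewrite spinor_twist spinor_rho /spinor su4_invK // E scalemxAl.
Qed.

Lemma outer_twist P (x : Gam) : SU4 P ->
  P *m map_mx Num.conj (rho_mx (f x)) = eta x *: (rho_mx (f x) *m P) ->
  twist eta r x = ((su4_inv sigma P * J) * r x * (su4_inv sigma P * J)^-1)%g.
Proof.
move=> SP E; set p := su4_inv sigma P.
have -> : ((p * J) * r x * (p * J)^-1 = p * (J * r x * J^-1) * p^-1)%g.
  by rewrite invMg !mulgA.
apply: inner_conjP; rewrite ?twist_N0 ?su4_inv_N0 //; first exact/N0_J/rho_N0.
by rewrite spinor_twist JE ?rho_N0 // spinor_rho /spinor su4_invK // E scalemxAl.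
Qed.

End Outer.
End Conjugation.

Section SignPairs.
Variables (R : realType) (Gam : groupType) (f : {multiplicative Gam -> calG R}).
Local Notation eta x := (upsilon (f x)).
Local Notation df x := (dchar (f x)).

Lemma calG_fstM (g h : calG R) : calG_fst (g * h)%g = (calG_fst g * calG_fst h)%g.
Proof. by []. Qed.

Lemma calG_sndM (g h : calG R) : calG_snd (g * h)%g = (calG_snd g * calG_snd h)%g.
Proof. by []. Qed.

Lemma upsilonM (g h : calG R) : upsilon (g * h)%g = upsilon g * upsilon h.
Proof. by rewrite /upsilon calG_fstM epsilon_mul. Qed.

Lemma dcharM (g h : calG R) : dchar (g * h)%g = dchar g * dchar h.
Proof. by rewrite /dchar calG_fstM O2pm_mxM det_mulmx. Qed.

Lemma dcharP (g : calG R) : dchar g = 1 \/ dchar g = -1.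
Proof.
have /eqP := det_O2pm (calG_fst g).
by rewrite -expr2 sqrf_eq1 => /orP[] /eqP; [left | right].
Qed.

(** Two distinct nontrivial characters with values in {1, -1} are independent. *)
Lemma sign_pairs : (fun x => df x) <> (fun x => eta x) -> (fun x => df x) <> (fun=> 1) ->
  (fun x => eta x) <> (fun=> 1) ->
  (exists x, eta x = 1 /\ df x = -1) /\ (exists x, eta x = -1 /\ df x = -1).
Proof.
move=> de d1 e1.
have ex (h k : Gam -> R[i]) : h <> k -> exists x, h x <> k x.
  move=> hk; apply: contrapT => /forallNP H; apply: hk; apply: funext => x.
  by apply: contrapT; apply: H.
have [x dex] := ex _ _ de; have [y dy] := ex _ _ d1; have [z ez] := ex _ _ e1.
have M u w : eta (u * w)%g = eta u * eta w by rewrite gmulfM upsilonM.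
have D u w : df (u * w)%g = df u * df w by rewrite gmulfM dcharM.
have dy' : df y = -1 by case: (dcharP (f y)).
have ez' : eta z = -1 by case: (upsilonP (f z)).
have NN : (-1 : R[i]) * -1 = 1 by rewrite mulrNN mulr1.
have [ey|ey] := upsilonP (f y); have [dz|dz] := dcharP (f z).
- split; first by exists y; split; [exact: ey | exact: dy'].
  exists (y * z)%g; rewrite M D ey dy' ez' dz.
  by split; [exact: mul1r | exact: mulr1].
- split; first by exists y; split; [exact: ey | exact: dy'].
  by exists z; split; [exact: ez' | exact: dz].
- split; last by exists y; split; [exact: ey | exact: dy'].
  exists (y * z)%g; rewrite M D ey dy' ez' dz.
  by split; [exact: NN | exact: mulr1].
have [ex'|ex'] := upsilonP (f x); have [dx|dx] := dcharP (f x).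
- by case: dex; rewrite ex' dx.
- by split; [exists x | exists y]; split; [exact: ex' | exact: dx | exact: ey | exact: dy'].
- split; last by exists y; split; [exact: ey | exact: dy'].
  exists (x * y)%g; rewrite M D ex' dx ey dy'.
  by split; [exact: NN | exact: mul1r].
by case: dex; rewrite ex' dx.
Qed.

End SignPairs.

Theorem proposition5p10 (R : realType) (v : 'cV[R]_7) (hv : v != 0)
    (sigma : half_spin v) (Gam : groupType)
    (f : {multiplicative Gam -> calG R}) :
  let eta : Gam -> R[i] := @upsilon R \o f in
  let df : Gam -> R[i] := @dchar R \o f in
  let r : Gam -> N v := rho sigma \o f in
  let f1 : Gam -> O2pm R := @calG_fst R \o f in
  let f2 : Gam -> O2pm R := @calG_snd R \o f in
  df <> eta -> df <> (fun=> 1) -> eta <> (fun=> 1) ->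
  element_conjugate r (twist eta r) /\
  (~ group_conjugate r (twist eta r) <->
     ~ image_isog f1 ('D_8)%type /\ ~ image_isog f2 ('D_8)%type).
Proof.
move=> eta df r f1 f2 de d1 e1.
have [J JN JE] := outer_conjugation sigma hv.
have [[b [eb db]] [a [ea da]]] := sign_pairs de d1 e1.
have [F1 F1E] : exists phi : {multiplicative Gam -> O2pm R}, f1 = phi.
  by apply: multiplicative_exists => x y; rewrite /f1 /= gmulfM calG_fstM.
have [F2 F2E] : exists phi : {multiplicative Gam -> O2pm R}, f2 = phi.
  by apply: multiplicative_exists => x y; rewrite /f2 /= gmulfM calG_sndM.
have f1E x : F1 x = calG_fst (f x) by rewrite -F1E.
have f2E x : F2 x = calG_snd (f x) by rewrite -F2E.
have e1x x : epsilon (O2pm_mx (F1 x)) = upsilon (f x) by rewrite f1E.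
have m1x x : simf (O2pm_mx (F1 x)) = upsilon (f x) * dchar (f x).
  by rewrite f1E calG_simf1.
have e2x x : epsilon (O2pm_mx (F2 x)) = upsilon (f x) * dchar (f x).
  by rewrite f2E calG_epsilon2.
have m2x x : simf (O2pm_mx (F2 x)) = upsilon (f x) by rewrite f2E calG_simf2.
have rhoE x : rho_mx (f x) = bdiag (O2pm_mx (F1 x)) (O2pm_mx (F2 x)).
  by rewrite f1E f2E.
have rhoC x : map_mx Num.conj (rho_mx (f x)) =
    bdiag ((upsilon (f x) * dchar (f x)) *: O2pm_mx (F1 x))
      (upsilon (f x) *: O2pm_mx (F2 x)).
  by rewrite rhoE bdiag_conj !conj_O2 m1x m2x.
have rot1 x : rot90 *m O2pm_mx (F1 x) = upsilon (f x) *: (O2pm_mx (F1 x) *m rot90).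
  by rewrite rot_comm scalerA e1x epsilon_sqr scale1r.
have rot2 x : rot90 *m O2pm_mx (F2 x) =
    (upsilon (f x) * dchar (f x)) *: (O2pm_mx (F2 x) *m rot90).
  by rewrite rot_comm scalerA -e2x epsilon_sqr scale1r.
have NN : (-1 : R[i]) * -1 = 1 by rewrite mulrNN mulr1.
have one_u : (1%:M : 'M[R[i]]_2) \is unitarymx.
  by rewrite -(O2pm_mx1 R); have [] := O2pmP (1%g : O2pm R).
split.
  move=> x; have [ex|ex] := upsilonP (f x).
    by exists 1%g; rewrite invg1 mulg1 mul1g /twist /eta /= ex -addr_eq0 -mulr2n pnatr_eq0.
  have [dx|dx] := dcharP (f x).
    (* Both components anticommute with rot90. *)
    have S : SU4 (bdiag rot90 rot90 : 'M[R[i]]_4).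
      by apply: SU4_bdiag; rewrite ?rot_unitary ?det_rot ?mulr1.
    exists (su4_inv sigma (bdiag rot90 rot90)).
    apply: (@inner_twist _ _ sigma hv _ f _ x S).
    by rewrite rhoE !bdiagM rot1 rot2 dx mulr1 bdiagZ.
  (* Here f1 x is real, while complex conjugation changes the sign of f2 x. *)
  have S : SU4 (bdiag rot90 1%:M : 'M[R[i]]_4).
    by apply: SU4_bdiag; rewrite ?rot_unitary // ?det_rot ?det1 ?mulr1.
  exists (su4_inv sigma (bdiag rot90 1%:M) * J)%g.
  apply: (@outer_twist _ _ sigma hv _ JE _ f _ x S).
  rewrite rhoC rhoE !bdiagM bdiagZ -scalemxAr rot1 mul1mx mulmx1 dx ex.
  by rewrite NN scale1r.
(* With the values (epsilon, mu) below, a is a reflection and b a candidate quarter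
   turn for f1; for f2 the roles of a and b are exchanged. *)
have Ea1 : epsilon (O2pm_mx (F1 a)) = -1 by rewrite e1x; exact: ea.
have Ma1 : simf (O2pm_mx (F1 a)) = 1 by rewrite m1x ea da NN.
have Eb1 : epsilon (O2pm_mx (F1 b)) = 1 by rewrite e1x; exact: eb.
have Mb1 : simf (O2pm_mx (F1 b)) = -1 by rewrite m1x eb db mul1r.
have Ea2 : epsilon (O2pm_mx (F2 a)) = 1 by rewrite e2x ea da NN.
have Ma2 : simf (O2pm_mx (F2 a)) = -1 by rewrite m2x; exact: ea.
have Eb2 : epsilon (O2pm_mx (F2 b)) = -1 by rewrite e2x eb db mul1r.
have Mb2 : simf (O2pm_mx (F2 b)) = 1 by rewrite m2x; exact: eb.
suff H : group_conjugate r (twist eta r) <->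
    image_isog f1 ('D_8)%type \/ image_isog f2 ('D_8)%type.
  by rewrite H; apply: not_orP.
rewrite F1E F2E; split.
  move=> [y yE].
  have tr_eq x : upsilon (f x) * (\tr (O2pm_mx (F1 x)) + \tr (O2pm_mx (F2 x))) =
      \tr (spinor sigma (y * r x * y^-1)%g).
    by rewrite -yE (spinor_twist sigma hv) mxtraceZ rhoE bdiag_tr.
  have self_opp (t : R[i]) : t = - t -> t = 0.
    by move/eqP; rewrite -addr_eq0 -mulr2n mulrn_eq0 => /eqP.
  have [Ny|Ny] := boolP (N0 v y); [right | left].
    apply: (quarter_turns_dihedral Ea2 Ma2 Eb2 Mb2) => x ex mx.
    have := tr_eq x; rewrite (inner_trace sigma hv Ny (rho_N0 _ _)).
    rewrite spinor_rho rhoE bdiag_tr -m2x mx.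
    rewrite (@trace_reflection _ (F1 x)) ?e1x -?m2x // !add0r mulN1r => E.
    by apply: self_opp; rewrite E.
  apply: (quarter_turns_dihedral Eb1 Mb1 Ea1 Ma1) => x ex mx.
  have dx : dchar (f x) = -1 by move: mx; rewrite m1x -e1x ex mul1r.
  have := tr_eq x; rewrite (outer_trace hv JN JE Ny (rho_N0 _ _)).
  rewrite spinor_rho rhoC bdiag_tr !mxtraceZ dx -e1x ex !mul1r.
  rewrite (@trace_reflection _ (F2 x)) ?e2x -?e1x ?ex ?dx ?mul1r // !addr0 mulN1r.
  exact: self_opp.
move=> [iso1|iso2].
  have q := dihedral_quarter_turns Ea1 iso1.
  pose c := (F1 a * F1 b)%g : O2pm R.
  have S : SU4 (bdiag (O2pm_mx c) 1%:M : 'M[R[i]]_4).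
    have U : O2pm_mx c \is unitarymx by have [] := O2pmP c.
    apply: (SU4_bdiag U one_u).
    rewrite det1 mulr1 det_epsilon simf_mul epsilon_mul Ea1 Ma1 Eb1 Mb1 mul1r mulr1.
    exact: NN.
  exists (su4_inv sigma (bdiag (O2pm_mx c) 1%:M) * J)%g => x.
  apply: (@outer_twist _ _ sigma hv _ JE _ f _ x S).
  rewrite rhoC rhoE !bdiagM bdiagZ mul1mx mulmx1 -scalemxAr.
  rewrite (det_conjugator Eb1 Mb1 Ea1 Ma1 q x) scalerA f1E -/(dchar (f x)) -mulrA.
  by have [->|->] := dcharP (f x); rewrite ?NN ?mulr1.
(* The factor i makes the determinant of the second block equal to 1. *)
have q := dihedral_quarter_turns Eb2 iso2.
pose P : 'M[R[i]]_4 := bdiag rot90 ('i%C *: O2pm_mx (F2 b)).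
have S : SU4 P.
  have /unitary_i U : O2pm_mx (F2 b) \is unitarymx by have [] := O2pmP (F2 b : O2pm R).
  apply: (SU4_bdiag (rot_unitary R) U).
  rewrite det_rot mul1r detZ expr2 Defs.sqr_i det_epsilon Eb2 Mb2 mul1r.
  exact: NN.
exists (su4_inv sigma P) => x; apply: (@inner_twist _ _ sigma hv _ f _ x S).
rewrite rhoE !bdiagM bdiagZ rot1 -scalemxAl -scalemxAr.
rewrite (simf_conjugator Ea2 Ma2 Eb2 Mb2 q x) m2x.
by rewrite !scalerA mulrC.
Qed.
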